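(* Let $n\ge1$, let $\mathcal{T}_n$ be an $n$-periodic triangulation of the strip $\mathcal{U}_n$ with associated $n$-arithmetic frieze $\mathcal{F}_{\mathcal{T}_n}=(m_{ij})_{j-i\ge -2}$. Then (for all $i,j\in\mathbb{Z}$ with $j-i\ge-2$ and any $k\in\mathbb{Z}$) $$m_{ij}=n_{(i-1)^{(k)}}\!\left((j+1)^{(k)}\right).$$
   Context: Infinite friezes: an infinite frieze is an array $(m_{ij})_{i,j\in\mathbb{Z},\,j-i\ge -2}$ of integers with $m_{i,i-2}=0$, $m_{i,i-1}=1$ for all $i$, $m_{ij}>0$ for all $j\ge i$, and $m_{ij}m_{i+1,j+1}-m_{i+1,j}m_{i,j+1}=1$ for all $j-i\ge -1$. It is $n$-periodic if $m_{ij}=m_{i+n,j+n}$ for all $i\le j$; its quiddity sequence is then $(m_{11},\dots,m_{nn})$, which determines it. Strip: $\mathcal{U}_n$ is $\mathbb{R}\times$ (closed interval) with vertices $0^{(k)}$, $k\in\mathbb{Z}$, on the upper boundary and vertices $1^{(k)},\dots,n^{(k)}$, $k\in\mathbb{Z}$, on the lower boundary, ordered from left to right on the lower boundary by: $i^{(k)}\le j^{(l)}$ iff $k<l$, or $k=l$ and $i\le j$; the vertices $0^{(k)}$ are ordered from left to right by $k$, with $0^{(k)}$ above $1^{(k)},\dots,n^{(k)}$. Convention: $(i+ln)^{(k)}=i^{(k+l)}$ for $1\le i\le n$, $l\in\mathbb{Z}$, so $i^{(k)}$ makes sense for every $i\in\mathbb{Z}$ as a lower vertex. An arc in $\mathcal{U}_n$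 is (the isotopy class of) a non-self-intersecting curve connecting two vertices such that (A1) at least one vertex is on the lower boundary; (A2) the two vertices are neither equal nor neighbors; (A3) if one vertex is on the upper boundary, the superscripts of the two vertices are equal (so the arcs to the upper boundary are $0^{(k)}j^{(k)}$, $1\le j\le n$). A triangulation of $\mathcal{U}_n$ is a maximal collection of arcs that pairwise do not meet in the interior of $\mathcal{U}_n$; the regions into which it cuts $\mathcal{U}_n$ are called triangles. It is $n$-periodic if it has a fundamental domain: an $(n+3)$-gon $\mathcal{P}$ with vertices $0^{(k)},0^{(k+1)}$ and $i^{(k)},(i+1)^{(k)},\dots,n^{(k)},1^{(k+1)},\dots,i^{(k+1)}$ for some $i\in\{1,\dots,n\}$, $k\in\mathbb{Z}$, bounded on the sides by the arcs $0^{(k)}i^{(k)}$ and $0^{(k+1)}i^{(k+1)}$ of the triangulation, such that the triangulation is covered by the horizontal translates of $\mathcal{P}$ (shifting superscripts by integers). In an $n$-periodic triangulation each triangle is either bounded by three sides, or is a four-sided region with vertices $i^{(k)},i'^{(k+1)},0^{(k)},0^{(k+1)}$ having one side on the upper boundary (such a region also counts as a triangle). Associated frieze: the quiddity sequence of an $n$-periodic triangulation $\mathcal{T}_n$ is $(a_1,\dots,a_n)$, where $a_i$ is the number of triangles of $\mathcal{T}_n$ incident with $i^{(k)}$ (independent of $k$). $\mathcal{F}_{\mathcal{T}_n}$ is the $n$-periodic infinite frieze with $m_{ii}=a_i$ for $1\le i\le n$ (it exists and is $n$-arithmetic, meaning that for all $i\in\mathbb{Z}$ and $k\in\{1,\dots,n\}$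 the difference $m_{i,(i+k-3)+(l+1)n}-m_{i,(i+k-3)+ln}$ is the same for all $l\ge0$). Labels: fix a starting vertex $v$ on the lower boundary. Labels $n_v(w)\in\mathbb{Z}_{\ge0}$ are attached to all vertices $w$ of $\mathcal{U}_n$ as follows. Set $n_v(v)=0$ and $n_v(w)=1$ whenever $w$ is joined with $v$ by a boundary segment or by an arc of $\mathcal{T}_n$ ($w$ may lie on the upper boundary). As soon as one vertex on the upper boundary receives a label, all vertices on the upper boundary receive that same label. Next, iteratively: whenever three lower vertices $w_1,w_2,w_3$ form a triangle of $\mathcal{T}_n$ with $w_1,w_2$ labeled and $w_3$ not, set $n_v(w_3)=n_v(w_1)+n_v(w_2)$. When no such triangle is left, consider triangles of $\mathcal{T}_n$ having two lower vertices and touching the upper boundary, either with vertices $i^{(k)},i'^{(k)},0^{(k)}$ or with vertices $i^{(k)},i'^{(k+1)},0^{(k)},0^{(k+1)}$; in the latter case $0^{(k)}$ and $0^{(k+1)}$ are regarded as one single vertex with a common label. If two of the three (so regarded) vertices are labeled, the remaining one gets the sum of the two labels. Continue in this way with all triangles until all vertices are labeled. *)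

(* Defs.v *)
From HB Require Import structures.
From mathcomp Require Import all_boot all_order all_algebra.
From mathcomp Require Import all_classical.

Set Implicit Arguments.
Unset Strict Implicit.
Unset Printing Implicit Defensive.

Import Order.TTheory GRing.Theory Num.Theory.

Local Open Scope classical_set_scope.
Local Open Scope card_scope.
Local Open Scope ring_scope.

(* Infinite friezes.  Only the entries m i j with j - i >= -2 are meaningful. *)

Definition infinite_frieze (m : int -> int -> int) : Prop :=
  [/\ forall i : int, m i (i - 2) = 0,
      forall i : int, m i (i - 1) = 1,
      forall i j : int, i <= j -> 0 < m i j &
      forall i j : int, -1 <= j - i ->
        m i j * m (i + 1) (j + 1) - m (i + 1) j * m i (j + 1) = 1].

Definition periodic_frieze (n : nat) (m : int -> int -> int) : Prop :=
  forall i j : int, i <= j -> m i j = m (i + n%:Z) (j + n%:Z).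

(* Upper k is 0^(k).  The lower vertices are numbered from left to right by
   int, so that Lower (i + k * n) is i^(k); this makes the convention
   (i + l n)^(k) = i^(k + l) hold by construction. *)

Inductive vertex : Type := Upper of int | Lower of int.

Definition sum_of_vertex (x : vertex) : int + int :=
  match x with Upper k => inl k | Lower p => inr p end.
Definition vertex_of_sum (s : int + int) : vertex :=
  match s with inl k => Upper k | inr p => Lower p end.
Lemma sum_of_vertexK : cancel sum_of_vertex vertex_of_sum.
Proof. by case. Qed.
HB.instance Definition _ := Equality.copy vertex (can_type sum_of_vertexK).

Definition is_upper (x : vertex) : bool := if x is Upper _ then true else false.
Definition is_lower (x : vertex) : bool := ~~ is_upper x.

Definition lower_vertex (n : nat) (i k : int) : vertex := Lower (i + k * n%:Z).

(* The k with Lower p = i^(k) and 1 <= i <= n (floor division, for n > 0). *)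
Definition superscript (n : nat) (p : int) : int := ((p - 1) %/ n%:Z)%Z.

Definition neighbors (x y : vertex) : bool :=
  match x, y with
  | Upper k, Upper l => `|k - l| == 1
  | Lower p, Lower q => `|p - q| == 1
  | _, _ => false
  end.

(* Order of the vertices along the boundary of the disc U_n: the lower boundary
   from left to right, then the upper boundary from right to left. *)
Definition before (x y : vertex) : bool :=
  match x, y with
  | Lower p, Lower q => p < q
  | Lower _, Upper _ => true
  | Upper _, Lower _ => false
  | Upper k, Upper l => l < k
  end.

(* U_n is simply connected, so the isotopy class of an arc is its unordered pair
   of endpoints, represented here by the pair sorted along [before]. *)
Definition is_arc (n : nat) (e : vertex * vertex) : bool :=
  [&& before e.1 e.2,
      is_lower e.1 || is_lower e.2,
      ~~ neighbors e.1 e.2 &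
      if e is (Lower p, Upper k) then superscript n p == k else true].

(* Two arcs (in minimal position) meet in the interior iff their endpoints
   interlace along the boundary. *)
Definition crossing (e f : vertex * vertex) : bool :=
  [&& before e.1 f.1, before f.1 e.2 & before e.2 f.2] ||
  [&& before f.1 e.1, before e.1 f.2 & before f.2 e.2].

Definition noncrossing_arcs (n : nat) (T : set (vertex * vertex)) : Prop :=
  (forall e, T e -> is_arc n e) /\ (forall e f, T e -> T f -> ~~ crossing e f).

Definition triangulation (n : nat) (T : set (vertex * vertex)) : Prop :=
  noncrossing_arcs n T /\
  (forall S, noncrossing_arcs n S -> T `<=` S -> S = T).

Definition translate (n : nat) (l : int) (x : vertex) : vertex :=
  match x with Upper k => Upper (k + l) | Lower p => Lower (p + l * n%:Z) end.

(* The vertices of the (n+3)-gon with sides 0^(k) i^(k) and 0^(k+1) i^(k+1). *)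
Definition polygon (n : nat) (i k : int) (x : vertex) : bool :=
  match x with
  | Upper l => (l == k) || (l == k + 1)
  | Lower p => (i + k * n%:Z <= p) && (p <= i + (k + 1) * n%:Z)
  end.

Definition periodic_triangulation (n : nat) (T : set (vertex * vertex)) : Prop :=
  triangulation n T /\
  exists i k : int,
    [/\ 1 <= i <= n%:Z,
        T (lower_vertex n i k, Upper k),
        T (lower_vertex n i (k + 1), Upper (k + 1)) &
        T = [set e | exists (l : int) e0,
               [/\ T e0, polygon n i k e0.1, polygon n i k e0.2 &
                   e = (translate n l e0.1, translate n l e0.2)]]].

Definition joined (T : set (vertex * vertex)) (x y : vertex) : Prop :=
  [\/ neighbors x y, T (x, y) | T (y, x)].

Definition three_sided (T : set (vertex * vertex)) (x y z : vertex) : Prop :=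
  [/\ joined T x y, joined T y z & joined T x z].

Definition four_sided (T : set (vertex * vertex)) (p q k : int) : Prop :=
  [/\ joined T (Lower p) (Lower q),
      joined T (Lower p) (Upper k) &
      joined T (Lower q) (Upper (k + 1))].

(* A triangle is identified with its set of vertices. *)
Definition triangle (T : set (vertex * vertex)) (t : set vertex) : Prop :=
  (exists x y z, three_sided T x y z /\ t = [set x; y; z]) \/
  (exists p q k, four_sided T p q k /\
     t = [set Lower p; Lower q; Upper k; Upper (k + 1)]).

Definition quiddity (n : nat) (T : set (vertex * vertex)) (a : int -> nat) : Prop :=
  forall i k : int, 1 <= i <= n%:Z ->
    [set t | triangle T t /\ t (lower_vertex n i k)] #= `I_(a i).

Definition associated_frieze (n : nat) (T : set (vertex * vertex))
    (m : int -> int -> int) : Prop :=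
  [/\ infinite_frieze m, periodic_frieze n m &
      exists a, quiddity n T a /\
        forall i : int, 1 <= i <= n%:Z -> m i i = (a i)%:Z].

(* Labels.  A state of the labeling procedure is a partial labeling. *)

Definition same_label (x y : vertex) : bool := (x == y) || (is_upper x && is_upper y).

Definition initial_labels (T : set (vertex * vertex)) (v : vertex) :
    vertex -> option nat :=
  fun w => if w == v then Some 0%N
           else if `[< exists2 u, same_label u w & joined T v u >] then Some 1%N
           else None.

Definition set_label (L : vertex -> option nat) (w : vertex) (x : nat) :
    vertex -> option nat :=
  fun u => if same_label u w then Some x else L u.

Definition lower_triangle (T : set (vertex * vertex)) (w1 w2 w3 : vertex) : Prop :=
  [/\ is_lower w1, is_lower w2, is_lower w3 & three_sided T w1 w2 w3].

(* In the four-sided case Upper k stands for both upper vertices, which always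
   carry the same label. *)
Definition upper_triangle (T : set (vertex * vertex)) (w1 w2 w3 : vertex) : Prop :=
  exists p q k : int,
    (three_sided T (Lower p) (Lower q) (Upper k) \/ four_sided T p q k) /\
    perm_eq [:: w1; w2; w3] [:: Lower p; Lower q; Upper k].

(* Some triangle in tri has w as its only unlabeled vertex, and the labels of
   the other two add up to x. *)
Definition completes (tri : vertex -> vertex -> vertex -> Prop)
    (L : vertex -> option nat) (w : vertex) (x : nat) : Prop :=
  exists w1 w2 x1 x2,
    [/\ tri w1 w2 w, L w1 = Some x1, L w2 = Some x2, L w = None & x = (x1 + x2)%N].

Inductive reachable (T : set (vertex * vertex)) (v : vertex) :
    (vertex -> option nat) -> Prop :=
| reachable_initial : reachable T v (initial_labels T v)
| reachable_lower L w x : reachable T v L ->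
    completes (lower_triangle T) L w x -> reachable T v (set_label L w x)
| reachable_upper L w x : reachable T v L ->
    (forall u y, ~ completes (lower_triangle T) L u y) ->
    completes (upper_triangle T) L w x -> reachable T v (set_label L w x).

(* n_v(w): the label w receives in the procedure started at v.  The default 0 is
   never used for periodic triangulations, where every vertex gets labeled. *)
Definition label (T : set (vertex * vertex)) (v w : vertex) : nat :=
  xget 0%N [set x | exists2 L, reachable T v L & L w = Some x].

(* Main.v *)
Require Import Defs.
From mathcomp Require Import all_boot all_order all_algebra.
From mathcomp Require Import all_classical.
From mathcomp Require Import zify ring.

(* Collapse the upper boundary to one point.  The triangulation then becomes a
   Farey-like triangulation whose vertices carry vectors u of the integer plane,
   with det(u_p, u_q) = 1 on every edge p < q: the collapsed point gets (0, 1),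
   the lower vertices joined to it get (1, t) for consecutive t, and the others
   are mediants.  Let F(x, y) = |det(u_x, u_y)|.
   Labels: det(u_v, -) is additive on triangles up to signs, so in each triangle
   one of the numbers F(v, -) is the sum of the other two, and the procedure
   started at v computes F(v, -).
   Frieze: the vectors of the neighbors of p, taken in order with suitable signs,
   decrease by u_p at each step from u_{p+1} to -u_{p-1}, so the number of
   triangles at p is det(u_{p-1}, u_{p+1}).  The Pluecker relation is the
   unimodular rule, hence m_{ij} = det(u_{i-1}, u_{j+1}) by uniqueness. *)

Set Implicit Arguments.
Unset Strict Implicit.
Unset Printing Implicit Defensive.

Import Order.TTheory GRing.Theory Num.Theory.

Local Open Scope classical_set_scope.
Local Open Scope card_scope.
Local Open Scope ring_scope.

(** * Counting and extrema over the integers *)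

Lemma count_lt (A : eqType) (a b : pred A) (l : seq A) z :
  (forall y, a y -> b y) -> z \in l -> b z -> ~~ a z -> (count a l < count b l)%N.
Proof.
move=> ab + bz az; elim: l => //= y l IH; rewrite inE => /orP[/eqP <-|zl].
  by rewrite bz (negbTE az) add0n add1n ltnS; apply: sub_count.
by have := IH zl; have /implyP := ab y; case: (a y) (b y) => [] [] //= _; lia.
Qed.

Lemma int_max (P : int -> Prop) (a b : int) :
  P a -> (forall x, P x -> x <= b) ->
  exists x, [/\ P x, a <= x & forall y, P y -> y <= x].
Proof.
move=> Pa Pb.
have [k] : exists k : nat, b - a <= k%:Z by exists `|b - a|%N; lia.
elim: k a Pa => [|k IH] a Pa hk; first by exists a; split=> // y /Pb; lia.
have [[y [Py ay]]|noy] := pselect (exists y, P y /\ a < y).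
  have [|x [Px yx xP]] := IH y Py; first by lia.
  by exists x; split=> //; lia.
exists a; split=> // y Py; case: (leP y a) => // ay.
by case: noy; exists y.
Qed.

Lemma int_min (P : int -> Prop) (a b : int) :
  P a -> (forall x, P x -> b <= x) ->
  exists x, [/\ P x, x <= a & forall y, P y -> x <= y].
Proof.
move=> Pa Pb; have [|x|x [Px ax xP]] := @int_max (fun x => P (- x)) (- a) (- b).
- by rewrite opprK.
- by move/Pb; lia.
exists (- x); split=> // [|y Py]; first by lia.
by have := xP (- y); rewrite opprK => /(_ Py); lia.
Qed.

(** * Combinatorics of a triangulated strip with merged upper boundary *)

(* The combinatorics of a triangulated strip once all upper vertices are merged
   into one point: [E p q] are the edges p < q between lower vertices, boundary
   segments included, and [B p] are the edges to the upper boundary. *)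
Record strip (E : int -> int -> Prop) (B : int -> Prop) : Prop := Strip {
  edge_lt : forall p q, E p q -> p < q;
  edge_succ : forall p, E p (p + 1);
  edge_nc : forall p q r s, E p q -> E r s -> p < r -> r < q -> q < s -> False;
  edge_bridge_nc : forall p q r, E p q -> B r -> p < r -> r < q -> False;
  edge_max : forall p q, p < q ->
    (forall r s, E r s -> p < r -> r < q -> q < s -> False) ->
    (forall r s, E r s -> r < p -> p < s -> s < q -> False) ->
    (forall r, B r -> p < r -> r < q -> False) -> E p q;
  bridge_max : forall p, (forall r s, E r s -> r < p -> p < s -> False) -> B p;
  bridge_below : forall p, exists2 q, q < p & B q;
  bridge_above : forall p, exists2 q, p < q & B q }.

(** Left-right reflection, which turns facts about the next bridge to the right into facts about the
    previous one. *)
Lemma strip_opp E B : strip E B ->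
  strip (fun p q => E (- q) (- p)) (fun p => B (- p)).
Proof.
move=> S; split.
- by move=> p q /(edge_lt S); lia.
- by move=> p; have := edge_succ S (- (p + 1)); rewrite opprD addrNK.
- by move=> p q r s Eqp Esr pr rq qs; apply: (edge_nc S Esr Eqp); lia.
- by move=> p q r Eqp Br pr rq; apply: (edge_bridge_nc S Eqp Br); lia.
- move=> p q pq c1 c2 cB; apply: (edge_max S); first by lia.
  + move=> r s Ers *; apply: (c2 (- s) (- r)); rewrite ?opprK //; lia.
  + move=> r s Ers *; apply: (c1 (- s) (- r)); rewrite ?opprK //; lia.
  + by move=> r Br *; apply: (cB (- r)); rewrite ?opprK //; lia.
- move=> p c; apply: (bridge_max S) => r s Ers *.
  by apply: (c (- s) (- r)); rewrite ?opprK //; lia.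
- by move=> p; have [q] := bridge_above S (- p); exists (- q); rewrite ?opprK //; lia.
- by move=> p; have [q] := bridge_below S (- p); exists (- q); rewrite ?opprK //; lia.
Qed.

(** The apex x is the last vertex before q joined to p. An edge crossing (x, q) would cross (p, q)
    or (p, x), or start at p and contradict the choice of x. *)
Lemma triangle_below E B p q : strip E B -> E p q -> p + 1 < q ->
  exists x, [/\ p < x, x < q, E p x & E x q].
Proof.
move=> S Epq pq.
have [||x [[xq Epx] _ xmax]] :=
  @int_max (fun x => x < q /\ E p x) (p + 1) q.
- by split; last exact: edge_succ S p.
- by move=> x [/ltW].
have px := edge_lt S Epx; exists x; split=> //.
apply: (edge_max S) => // [r s Ers xr rq qs|r s Ers rx xs sq|r Br xr rq].
- by apply: (edge_nc S Epq Ers) => //; lia.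
- have rs := edge_lt S Ers.
  case: (ltgtP r p) => rp.
  + by apply: (edge_nc S Ers Epq) => //; lia.
  + by apply: (edge_nc S Epx Ers).
  + by have := xmax s; rewrite -rp => /(_ (conj sq Ers)); lia.
- by apply: (edge_bridge_nc S Epq Br) => //; lia.
Qed.

(** Nothing crosses the segment between two consecutive bridge feet: an edge doing so would separate
    one of the feet from the upper boundary. *)
Lemma next_bridge E B p : strip E B -> B p ->
  exists q, [/\ E p q, B q & forall r, B r -> p < r -> q <= r].
Proof.
move=> S Bp; have [q0 pq0 Bq0] := bridge_above S p.
have [||q [[pq Bq] _ qmin]] := @int_min (fun q => p < q /\ B q) q0 p => //.
  by move=> x [/ltW].
exists q; split=> // [|r Br pr]; last exact: qmin.
apply: (edge_max S) => // [r s Ers pr rq qs|r s Ers rp ps sq|r Br pr].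
- exact: (edge_bridge_nc S Ers Bq).
- exact: (edge_bridge_nc S Ers Bp).
- by have := qmin r (conj pr Br); lia.
Qed.

Lemma prev_bridge E B p : strip E B -> B p ->
  exists q, [/\ E q p, B q & forall r, B r -> r < p -> r <= q].
Proof.
move=> S Bp; have [|q [Epq Bq qmin]] := next_bridge (p := - p) (strip_opp S).
  by rewrite opprK.
exists (- q); split=> // [|r Br rp]; first by rewrite opprK in Epq.
by have := qmin (- r); rewrite opprK => /(_ Br); lia.
Qed.

Lemma bridge_interval E B p : strip E B ->
  exists b c, [/\ B b, B c, E b c, b <= p & p < c].
Proof.
move=> S; have [b0 b0p Bb0] := bridge_below S p.
have [||b [[bp Bb] _ bmax]] := @int_max (fun b => b <= p /\ B b) b0 p.
- by split=> //; lia.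
- by move=> x [].
have [c [Ebc Bc cmin]] := next_bridge S Bb.
exists b, c; split=> //.
by case: (ltP p c) => // cp; have := bmax c (conj cp Bc); have := edge_lt S Ebc; lia.
Qed.

(* Take the shortest edge that strictly covers [p, q]: the triangle below it can
   only be the triangle above (p, q). *)
Lemma triangle_above E B p q : strip E B -> E p q ->
  [\/ B p /\ B q, exists2 s, E p s & E q s | exists2 r, E r p & E r q].
Proof.
move=> S Epq; have pq := edge_lt S Epq.
have [[Bp Bq]|nB] := pselect (B p /\ B q); first by constructor 1.
pose cov d := exists r s, [/\ E r s, r <= p, q <= s, d = s - r & q - p < d].
(* An endpoint that is not a bridge foot lies under some edge by [bridge_max]; since this edge does
   not cross (p, q), it covers [p, q] strictly. *)
have [r0 [s0 [Er0s0 [r0p qs0 d0]]]] :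
    exists r s, E r s /\ [/\ r <= p, q <= s & q - p < s - r].
  have [nBp|nBq] : ~ B p \/ ~ B q.
  - by have [Bp|] := pselect (B p); [right=> Bq; apply: nB | left].
  - apply: contrapT => nc; apply: nBp; apply: (bridge_max S) => r s Ers rp ps.
    apply: nc; exists r, s; split=> //.
    by case: (ltP s q) => sq; [case: (edge_nc S Ers Epq) | split; lia].
  - apply: contrapT => nc; apply: nBq; apply: (bridge_max S) => r s Ers rq qs.
    apply: nc; exists r, s; split=> //.
    by case: (ltP p r) => pr; [case: (edge_nc S Epq Ers) | split; lia].
have [||d [[r [s [Ers rp qs dE dgt]]] _ dmin]] := @int_min cov (s0 - r0) (q - p).
- by exists r0, s0; split.
- by move=> d [r [s [_ _ _ _ /ltW]]].
have [|x [rx xs Erx Exs]] := triangle_below S Ers; first by lia.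
(* If the apex x is not strictly between p and q, one side at x still covers [p, q]; being shorter
   than the minimal cover, it is (p, q) itself. Otherwise a side at x crosses (p, q). *)
have [xp|qx|[px xq]] : [\/ x <= p, q <= x | p < x /\ x < q].
- by case: (leP x p) => ?; [constructor 1|case: (leP q x) => ?; [constructor 2|constructor 3]].
- have [xpE sqE] : x = p /\ s = q.
    have [big|] := ltP (q - p) (s - x); last by lia.
    have /dmin : cov (s - x) by exists x, s; split. 
    by lia.
  by constructor 3; exists r; rewrite -?xpE // -sqE.
- have [xqE rpE] : x = q /\ r = p.
    have [big|] := ltP (q - p) (x - r); last by lia.
    have /dmin : cov (x - r) by exists r, x; split.
    by lia.
  by constructor 2; exists s; rewrite -?xqE // -rpE.
- case: (ltP r p) => ?; first by case: (edge_nc S Erx Epq).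
  by case: (edge_nc S Epq Exs) => //; lia.
Qed.

(** * Integer vectors with determinant 1 along edges *)

Definition unimodular_below (E : int -> int -> Prop) (p q : int)
    (X Y : int -> int) : Prop :=
  (forall z, p <= z -> z <= q -> 0 < X z) /\
  (forall r s, E r s -> p <= r -> s <= q -> X r * Y s - X s * Y r = 1).

(** Induction on q - p: the apex of the triangle below (p, q) gets the mediant of the two end
    vectors, which has determinant 1 with both, and the families below the two new edges are glued
    at it. *)
Lemma coordinates_below E B p q (a b c d : int) : strip E B -> E p q ->
  0 < a -> 0 < c -> a * d - c * b = 1 ->
  exists X Y : int -> int,
    [/\ X p = a, Y p = b, X q = c, Y q = d & unimodular_below E p q X Y].
Proof.
move=> S; have [k] : exists k : nat, q - p <= k%:Z by exists `|q - p|%N; lia.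
elim: k p q a b c d => [|k IH] p q a b c d hk Epq a0 c0 det1.
  by have := edge_lt S Epq; lia.
have pq := edge_lt S Epq.
have [qE|qp] : q = p + 1 \/ p + 1 < q by lia.
  exists (fun z => if z == p then a else c), (fun z => if z == p then b else d).
  have -> : (q == p) = false by lia.
  rewrite eqxx.
  split=> //; split=> [z _ _|r s Ers pr sq]; first by case: ifP.
  have rs := edge_lt S Ers; have -> : r = p by lia.
  have -> : s = q by lia.
  have -> : (q == p) = false by lia.
  by rewrite eqxx.
have [x [px xq Epx Exq]] := triangle_below S Epq qp.
have [||||X1 [Y1 [X1p Y1p X1x Y1x [pos1 det_1]]]] :=
  IH p x a b (a + c) (b + d) _ Epx; [lia..|].
have [||||X2 [Y2 [X2x Y2x X2q Y2q [pos2 det_2]]]] :=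
  IH x q (a + c) (b + d) c d _ Exq; [lia..|].
exists (fun z => if z < x then X1 z else X2 z), (fun z => if z < x then Y1 z else Y2 z).
have -> : (q < x) = false by lia.
rewrite px; split=> //; split=> [z pz zq|r s Ers pr sq].
  by case: ifP => zx; [apply: pos1 | apply: pos2]; lia.
have rs := edge_lt S Ers.
have [xr|rx] := leP x r.
  have -> : (s < x) = false by lia.
  by apply: det_2.
have [xs|sx] := leP x s; last by apply: det_1 => //; lia.
have [sE|xs'] : s = x \/ x < s by lia.
  by rewrite sE X2x Y2x -X1x -Y1x det_1 // -?sE //; lia.
(* An edge passing strictly over x can only be (p, q): any other would cross (p, x) or (x, q). *)
have -> : r = p by case: (ltP p r) => ?; [case: (edge_nc S Epx Ers) | lia].
have -> : s = q by case: (ltP s q) => ?; [case: (edge_nc S Ers Exq) | lia].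
by rewrite X1p Y1p X2q Y2q.
Qed.

Lemma int_antidifference (g : int -> int) :
  exists f : int -> int, forall p, f (p + 1) = f p + g p.
Proof.
exists (fun p => match p with
  | Posz k => \sum_(i < k) g i%:Z
  | Negz k => - \sum_(i < k.+1) g (Negz i) end).
case=> [k|[|k]].
- by rewrite -PoszD addn1 big_ord_recr.
- by rewrite /= big_ord0 big_ord1 addNr.
- have -> : Negz k.+1 + 1 = Negz k by lia.
  by rewrite [in RHS]big_ord_recr /= opprD addrNK.
Qed.

Lemma bridge_interval_uniq E B p b c b' c' : strip E B ->
  B b -> B c -> E b c -> b <= p -> p < c ->
  B b' -> B c' -> E b' c' -> b' <= p -> p < c' -> b' = b /\ c' = c.
Proof.
move=> S Bb Bc Ebc bp pc Bb' Bc' Ebc' bp' pc'.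
have bb' : b <= b' by rewrite leNgt; apply/negP=> h; apply: (edge_bridge_nc S Ebc' Bb); lia.
have b'b : b' <= b by rewrite leNgt; apply/negP=> h; apply: (edge_bridge_nc S Ebc Bb'); lia.
have cc' : c <= c' by rewrite leNgt; apply/negP=> h; apply: (edge_bridge_nc S Ebc Bc'); lia.
have c'c : c' <= c by rewrite leNgt; apply/negP=> h; apply: (edge_bridge_nc S Ebc' Bc); lia.
by split; lia.
Qed.

(** The collapsed upper point has the vector (0, 1), so the last clause says that the determinant
    along a bridge is 1. *)
Definition coordinates (E : int -> int -> Prop) (B : int -> Prop)
    (X Y : int -> int) : Prop :=
  [/\ forall p, 0 < X p,
      forall p q, E p q -> X p * Y q - X q * Y p = 1 &
      forall p, B p -> X p = 1].

(* The bridging vertices get the vectors (1, t), with t counting them from left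
   to right, and the other vertices are filled in by the mediant rule. *)
Lemma coordinates_exist E B : strip E B -> exists X Y, coordinates E B X Y.
Proof.
move=> S.
(* t grows by 1 exactly on arriving at a bridge foot, so consecutive feet get consecutive values. *)
have [t tS] := int_antidifference (fun p => if `[< B (p + 1) >] then 1 else 0).
have tE b c : B c -> E b c -> (forall r, B r -> b < r -> r < c -> False) -> t c = t b + 1.
  move=> Bc Ebc nB; have bc := edge_lt S Ebc.
  have tk (k : nat) : b + k%:Z < c -> t (b + k%:Z) = t b.
    elim: k => [|k IH] hk; first by rewrite addr0.
    have -> : b + k.+1%:Z = b + k%:Z + 1 by lia.
    rewrite tS IH; last by lia.
    case: asboolP => [Br|_]; last by rewrite addr0.
    by case: (nB _ Br); lia.
  have := tS (c - 1); rewrite subrK asboolT // => ->.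
  have -> : c - 1 = b + (absz (c - 1 - b)%R)%:Z by lia.
  by rewrite tk //; lia.
have /choice[bc bcP] z : exists bc : int * int,
    [/\ B bc.1, B bc.2, E bc.1 bc.2, bc.1 <= z & z < bc.2].
  by have [b [c ?]] := bridge_interval z S; exists (b, c).
have /choice[XY XYP] (e : int * int) : exists XY : (int -> int) * (int -> int),
    E e.1 e.2 -> [/\ XY.1 e.1 = 1, XY.2 e.1 = t e.1, XY.1 e.2 = 1,
      XY.2 e.2 = t e.1 + 1 & unimodular_below E e.1 e.2 XY.1 XY.2].
  (* The value chosen for a pair that is not an edge is arbitrary. *)
  have [Ee|nE] := pselect (E e.1 e.2); last by exists (id, id).
  have [||| X [Y XYP]] := coordinates_below (a := 1) (b := t e.1) (c := 1)
    (d := t e.1 + 1) S Ee; [lia..|].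
  by exists (X, Y).
have bcE b c z : B b -> B c -> E b c -> b <= z -> z < c -> bc z = (b, c).
  move=> Bb Bc Ebc bz zc; have [Bb' Bc' Ebc' bz' zc'] := bcP z.
  rewrite [bc z]surjective_pairing.
  by have [-> ->] := bridge_interval_uniq S Bb Bc Ebc bz zc Bb' Bc' Ebc' bz' zc'.
have start p : B p -> (XY (bc p)).1 p = 1 /\ (XY (bc p)).2 p = t p.
  move=> Bp; have [q [Epq Bq _]] := next_bridge S Bp.
  have pq := edge_lt S Epq; rewrite (bcE p q p) //.
  by have [] := XYP (p, q) Epq.
exists (fun z => (XY (bc z)).1 z), (fun z => (XY (bc z)).2 z); split.
- move=> z; have [_ _ Ebc bz zc] := bcP z.
  by have [_ _ _ _ [pos _]] := XYP _ Ebc; apply: pos => //; lia.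
- move=> p q Epq; have pq := edge_lt S Epq.
  have [Bb Bc Ebc bp pc] := bcP p; have [Xb Yb Xc Yc [_ dets]] := XYP _ Ebc.
  have qc : q <= (bc p).2.
    by rewrite leNgt; apply/negP=> cq; apply: (edge_bridge_nc S Epq Bc).
  have := dets _ _ Epq bp qc.
  (* The right end of an interval takes its vector from the next interval, where it is (1, t q); by
     [tE] this agrees with the vector (1, t b + 1) prescribed from the left, b being the left
     end. *)
  have [qE|qc'] : q = (bc p).2 \/ q < (bc p).2 by lia.
    have Bq : B q by rewrite qE.
    have [-> ->] := start q Bq; rewrite qE Xc Yc.
    by rewrite (tE _ _ Bc Ebc) // => r; apply: (edge_bridge_nc S Ebc).
  have -> : bc q = bc p by rewrite (bcE _ _ q Bb Bc) -?surjective_pairing //; lia.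
  by [].
- by move=> p Bp; case: (start p Bp).
Qed.

(** * Determinants between vertices of the collapsed triangulation *)

(* [None] is the point to which the upper boundary is collapsed. *)
Definition adj (E : int -> int -> Prop) (B : int -> Prop) (x y : option int) : Prop :=
  match x, y with
  | Some p, Some q => E p q \/ E q p
  | Some p, None | None, Some p => B p
  | None, None => False
  end.

Definition triad E B (x y z : option int) : Prop :=
  [/\ adj E B x y, adj E B y z & adj E B x z].

Lemma adj_sym E B (x y : option int) : adj E B x y -> adj E B y x.
Proof. by case: x y => [p|] [q|] //= []; [right|left]. Qed.

Lemma adj_irr E B (x : option int) : strip E B -> ~ adj E B x x.
Proof. by case: x => [p|//] S [] /(edge_lt S); rewrite ltxx. Qed.

Definition xcoord (X : int -> int) (x : option int) : int := if x is Some p then X p else 0.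
Definition ycoord (Y : int -> int) (x : option int) : int := if x is Some p then Y p else 1.
Definition pdet X Y x y : int := xcoord X x * ycoord Y y - xcoord X y * ycoord Y x.

Lemma pdetxx X Y (x : option int) : pdet X Y x x = 0.
Proof. by rewrite /pdet subrr. Qed.

Lemma pdetC X Y (x y : option int) : pdet X Y x y = - pdet X Y y x.
Proof. by rewrite /pdet opprB. Qed.

Lemma plucker X Y (a b c d : option int) :
  pdet X Y a b * pdet X Y c d - pdet X Y a c * pdet X Y b d
    + pdet X Y a d * pdet X Y b c = 0.
Proof. by rewrite /pdet; ring. Qed.

Lemma pdet_edge E B X Y (p q : int) : coordinates E B X Y -> E p q ->
  pdet X Y (Some p) (Some q) = 1.
Proof. by case=> _ + _; apply. Qed.

Lemma pdet_bridge E B X Y (p : int) : coordinates E B X Y -> B p -> pdet X Y (Some p) None = 1.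
Proof. by case=> _ _ /[apply]; rewrite /pdet /= mulr1 mul0r subr0. Qed.

(** The slope Y / X increases at every step along the lower boundary. Without fractions: the
    identity [e] passes positivity from r to r + 1, as X is positive. *)
Lemma pdet_gt0 E B X Y (p q : int) : strip E B -> coordinates E B X Y -> p < q ->
  0 < pdet X Y (Some p) (Some q).
Proof.
move=> S C pq; have [Xpos _ _] := C.
have -> : q = p + 1 + (absz (q - p - 1)%R)%:Z by lia.
elim: absz => [|k IH]; first by rewrite addr0 (pdet_edge C (edge_succ S p)).
have -> : p + 1 + k.+1%:Z = p + 1 + k%:Z + 1 by lia.
have := pdet_edge C (edge_succ S (p + 1 + k%:Z)).
move: (p + 1 + k%:Z) IH => r IH; set s := r + 1 => rs.
have e : pdet X Y (Some p) (Some s) * X r = pdet X Y (Some p) (Some r) * X s + X p.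
  by rewrite -[X p]mulr1 -rs /pdet /=; ring.
have : 0 < pdet X Y (Some p) (Some s) * X r by rewrite e addr_gt0 // mulr_gt0.
by rewrite pmulr_lgt0.
Qed.

Lemma pdet_eq0 E B X Y (x y : option int) : strip E B -> coordinates E B X Y ->
  pdet X Y x y = 0 -> x = y.
Proof.
move=> S C; have [Xpos _ _] := C; case: x y => [p|] [q|] //.
- have [pq|qp|->//] := ltgtP p q => e; exfalso; move: e.
  + by have := pdet_gt0 S C pq; lia.
  + by have := pdet_gt0 S C qp; rewrite pdetC; lia.
- by rewrite /pdet /= => e; have := Xpos p; lia.
- by rewrite /pdet /= => e; have := Xpos q; lia.
Qed.

Lemma pdet_adj E B X Y (x y : option int) : coordinates E B X Y -> adj E B x y ->
  pdet X Y x y = 1 \/ pdet X Y x y = -1.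
Proof.
move=> C; case: x y => [p|] [q|] //=.
- by case=> /(pdet_edge C) e; [left|right; rewrite pdetC e].
- by move/(pdet_bridge C); left.
- by move/(pdet_bridge C) => e; right; rewrite pdetC e.
Qed.

(** * The fan of neighbors around a vertex *)

(* If u_z is the vector of z, then for z adjacent to w this is det(u_v, +-u_z),
   with the sign normalized by det(u_w, +-u_z) = 1; it is affine along the fan
   of w. *)
Definition fan X Y w v z : int := pdet X Y w z * pdet X Y v z.

(** The Pluecker relation for w, v, z, z', in which the determinants of w with z and z' are
    signs. *)
Lemma fanB E B X Y (w v z z' : option int) : coordinates E B X Y -> adj E B w z -> adj E B w z' ->
  fan X Y w v z' - fan X Y w v z =
  pdet X Y w z * pdet X Y w z' * pdet X Y z z' * pdet X Y w v.
Proof.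
move=> C wz wz'; have := plucker X Y w v z z'; rewrite /fan.
by case: (pdet_adj C wz) (pdet_adj C wz') => -> [] ->; lia.
Qed.

Lemma fan_inj E B X Y (w v z z' : option int) : strip E B -> coordinates E B X Y ->
  adj E B w z -> adj E B w z' -> w <> v -> fan X Y w v z = fan X Y w v z' -> z = z'.
Proof.
move=> S C wz wz' wv e; apply: (pdet_eq0 S C).
have wv0 : pdet X Y w v <> 0 by move/(pdet_eq0 S C).
have := fanB v C wz wz'; rewrite e subrr => /esym/eqP.
rewrite mulf_eq0 => /orP[|/eqP//].
by case: (pdet_adj C wz) (pdet_adj C wz') => -> [] ->; lia.
Qed.

(** With v = p + 1 the scaling factor in [fanB] is 1, so the neighbors of p are numbered
    consecutively, from 0 at p + 1 up to the value at p - 1. *)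
Definition fan_succ X Y p := fan X Y (Some p) (Some (p + 1)).

Lemma fan_succB E B X Y (p : int) (z z' : option int) : strip E B -> coordinates E B X Y ->
  adj E B (Some p) z -> adj E B (Some p) z' ->
  fan_succ X Y p z' - fan_succ X Y p z =
  pdet X Y (Some p) z * pdet X Y (Some p) z' * pdet X Y z z'.
Proof.
move=> S C pz pz'; rewrite (fanB _ C pz pz') (pdet_edge C (edge_succ S p)).
by rewrite mulr1.
Qed.

Lemma fan_succ_pred E B X Y (p : int) : strip E B -> coordinates E B X Y ->
  fan_succ X Y p (Some (p - 1)) = pdet X Y (Some (p - 1)) (Some (p + 1)).
Proof.
move=> S C; have := pdet_edge C (edge_succ S (p - 1)); rewrite subrK => e.
by rewrite /fan_succ /fan pdetC e mulN1r -pdetC.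
Qed.

Lemma fan_succ_ge0 E B X Y (p : int) (z : option int) : strip E B -> coordinates E B X Y ->
  adj E B (Some p) z -> 0 <= fan_succ X Y p z.
Proof.
move=> S C; have [Xpos _ _] := C; rewrite /fan_succ /fan.
case: z => [q|] /=; last first.
  by move/(pdet_bridge C) => ->; have := Xpos (p + 1); rewrite /pdet /=; lia.
case=> Epq; have pq := edge_lt S Epq.
- rewrite (pdet_edge C Epq) mul1r.
  have [->|pq'] : q = p + 1 \/ p + 1 < q by lia.
    by rewrite pdetxx.
  by have := pdet_gt0 S C pq'; lia.
- rewrite pdetC (pdet_edge C Epq) pdetC.
  have pq' : q < p + 1 by lia.
  by have := pdet_gt0 S C pq'; lia.
Qed.

Lemma fan_succ_lt E B X Y (p : int) (z : option int) : strip E B -> coordinates E B X Y ->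
  adj E B (Some p) z -> z <> Some (p - 1) ->
  fan_succ X Y p z < fan_succ X Y p (Some (p - 1)).
Proof.
move=> S C pz zp; have [Xpos _ _] := C.
have Epp : E (p - 1) p by have := edge_succ S (p - 1); rewrite subrK.
have pp : adj E B (Some p) (Some (p - 1)) by right.
rewrite -subr_gt0 (fan_succB S C pz pp).
rewrite (pdetC _ _ (Some p) (Some (p - 1))) (pdet_edge C Epp).
case: z pz zp => [q|] /=; last first.
  by move/(pdet_bridge C) => -> _; have := Xpos (p - 1); rewrite /pdet /=; lia.
case=> Epq qp; have pq := edge_lt S Epq.
- rewrite (pdet_edge C Epq) pdetC.
  have pq' : p - 1 < q by lia.
  by have := pdet_gt0 S C pq'; lia.
- rewrite (pdetC _ _ (Some p)) (pdet_edge C Epq).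
  have pq' : q < p - 1 by have : q <> p - 1 by [move=> e; apply: qp; rewrite e]; lia.
  by have := pdet_gt0 S C pq'; lia.
Qed.

(** The next neighbor is the third vertex of the triangle on the other side of the edge from p to z:
    above it if z lies to the right, below it if z lies to the left, and at the previous bridge foot
    if z is the upper point. *)
Lemma fan_succ_next E B X Y (p : int) (z : option int) : strip E B -> coordinates E B X Y ->
  adj E B (Some p) z -> z <> Some (p - 1) ->
  exists z', triad E B (Some p) z z' /\ fan_succ X Y p z' = fan_succ X Y p z + 1.
Proof.
move=> S C pz zp.
suff [z' [zz' pz' e]] : exists z', [/\ adj E B z z', adj E B (Some p) z' &
    pdet X Y (Some p) z * pdet X Y (Some p) z' * pdet X Y z z' = 1].
  by exists z'; split=> //; have := fan_succB S C pz pz'; lia.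
case: z pz zp => [q|] /=; last first.
  move=> Bp _; have [b [Ebp Bb _]] := prev_bridge S Bp.
  exists (Some b); split=> //=; first by right.
  by rewrite (pdet_bridge C Bp) !(pdetC _ _ _ (Some b)) (pdet_edge C Ebp) (pdet_bridge C Bb).
case=> [Epq _|Eqp qp].
- have [[Bp Bq]|[s Eps Eqs]|[r Erp Erq]] := triangle_above S Epq.
  + exists None; split=> //.
    by rewrite (pdet_edge C Epq) (pdet_bridge C Bp) (pdet_bridge C Bq).
  + exists (Some s); split=> /=; [by left..|].
    by rewrite (pdet_edge C Epq) (pdet_edge C Eps) (pdet_edge C Eqs).
  + exists (Some r); split=> /=; [by right..|].
    by rewrite (pdet_edge C Epq) !(pdetC _ _ _ (Some r)) (pdet_edge C Erp) (pdet_edge C Erq).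
- have [|x [qx xp Eqx Exp]] := triangle_below S Eqp.
    have : q <> p - 1 by move=> e; apply: qp; rewrite e.
    by have := edge_lt S Eqp; lia.
  exists (Some x); split=> /=; [by left|by right|].
  by rewrite !(pdetC _ _ (Some p)) (pdet_edge C Eqp) (pdet_edge C Exp) (pdet_edge C Eqx).
Qed.

Lemma fan_succ_surj E B X Y (p : int) (s : nat) : strip E B -> coordinates E B X Y ->
  s%:Z < pdet X Y (Some (p - 1)) (Some (p + 1)) ->
  exists z z', [/\ triad E B (Some p) z z', fan_succ X Y p z = s%:Z &
    fan_succ X Y p z' = s%:Z + 1].
Proof.
move=> S C; rewrite -(fan_succ_pred p S C) => sr.
have [z pz zs] : exists2 z, adj E B (Some p) z & fan_succ X Y p z = s%:Z.
  elim: s sr => [|s IH] sr.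
    exists (Some (p + 1)); first by left; apply: (edge_succ S).
    by rewrite /fan_succ /fan pdetxx mulr0.
  have [|z pz zs] := IH; first by lia.
  have [|z' [[_ _ pz'] e]] := fan_succ_next S C pz; first by move=> e; rewrite e in zs; lia.
  by exists z' => //; lia.
have [|z' [t e]] := fan_succ_next S C pz; first by move=> e; rewrite e in zs; lia.
by exists z, z'; split=> //; lia.
Qed.

Lemma triad_fan_succ E B X Y (p : int) (z z' : option int) : strip E B -> coordinates E B X Y ->
  triad E B (Some p) z z' ->
  fan_succ X Y p z' = fan_succ X Y p z + 1 \/ fan_succ X Y p z = fan_succ X Y p z' + 1.
Proof.
move=> S C [pz zz' pz']; have := fan_succB S C pz pz'.
by case: (pdet_adj C pz) (pdet_adj C pz') (pdet_adj C zz') => -> [] -> [] ->; lia.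
Qed.

(** * Absolute determinants and the parents of a vertex *)

Definition fdist X Y x y : nat := absz (pdet X Y x y).

(** In the Pluecker relation for v, x, y, z the determinants within the triangle are signs, so the
    three determinants with v satisfy a linear relation with coefficients 1 or -1. *)
Lemma triad_fdist E B X Y (v x y z : option int) : coordinates E B X Y -> triad E B x y z ->
  [\/ fdist X Y v x = (fdist X Y v y + fdist X Y v z)%N,
      fdist X Y v y = (fdist X Y v x + fdist X Y v z)%N |
      fdist X Y v z = (fdist X Y v x + fdist X Y v y)%N].
Proof.
move=> C [xy yz xz]; have := plucker X Y v x y z.
have or3E (P Q R : Prop) : P \/ Q \/ R -> [\/ P, Q | R].
  by case=> [|[]]; [constructor 1|constructor 2|constructor 3].
case: (pdet_adj C xy) (pdet_adj C yz) (pdet_adj C xz) => -> [] -> [] -> e.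
all: by apply: or3E; rewrite /fdist; lia.
Qed.

Lemma triad_rot E B (x y z : option int) : triad E B x y z -> triad E B y z x.
Proof. by case=> xy yz xz; split=> //; apply: adj_sym. Qed.

Lemma triad_swap E B (x y z : option int) : triad E B x y z -> triad E B y x z.
Proof. by case=> xy yz xz; split=> //; apply: adj_sym. Qed.

(** Fan coordinates differ by multiples of det(u_v, u_w), so a smaller difference is 0. *)
Lemma fan_close E B X Y (w v z z' : option int) : strip E B -> coordinates E B X Y ->
  adj E B w z -> adj E B w z' ->
  (absz (fan X Y w v z' - fan X Y w v z) < fdist X Y v w)%N -> z = z'.
Proof.
move=> S C wz wz'; rewrite (fanB _ C wz wz') /fdist [pdet X Y v w]pdetC => h.
apply: (pdet_eq0 S C); move: h.
move: (pdet X Y z z') (pdet X Y w v) => a b.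
have [->//|a0] := eqVneq a 0.
have ab : (absz b <= absz a * absz b)%N by rewrite leq_pmull // absz_gt0.
by case: (pdet_adj C wz) (pdet_adj C wz') => -> [] ->; rewrite !abszM /=; lia.
Qed.

(* The fan coordinates of two parents of w lie on either side of 0, at distance
   F(v, w) from each other, and fan coordinates differ by multiples of F(v, w). *)
Lemma parents_uniq E B X Y (v w x y x' y' : option int) :
  strip E B -> coordinates E B X Y ->
  triad E B w x y -> triad E B w x' y' ->
  fdist X Y v w = (fdist X Y v x + fdist X Y v y)%N ->
  fdist X Y v w = (fdist X Y v x' + fdist X Y v y')%N ->
  [/\ v <> x, v <> y, v <> x' & v <> y'] ->
  x = x' /\ y = y' \/ x = y' /\ y = x'.
Proof.
move=> S C [wx xy wy] [wx' xy' wy'] e e' [vx vy vx' vy'].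
have fanE z : adj E B w z -> absz (fan X Y w v z) = fdist X Y v z.
  by move=> wz; rewrite /fan /fdist abszM; case: (pdet_adj C wz) => ->; rewrite mul1n.
have dist0 z : v <> z -> (0 < fdist X Y v z)%N.
  by move=> vz; rewrite absz_gt0; apply/eqP => /(pdet_eq0 S C).
have diff z z' : adj E B w z -> adj E B w z' -> adj E B z z' ->
    absz (fan X Y w v z' - fan X Y w v z) = fdist X Y v w.
  move=> wz wz' zz'; rewrite (fanB _ C wz wz') /fdist [pdet X Y v w]pdetC.
  by case: (pdet_adj C wz) (pdet_adj C wz') (pdet_adj C zz') => -> [] -> [] ->; lia.
have := diff _ _ wx wy xy; have := diff _ _ wx' wy' xy'.
have := fan_close (v := v) S C wx wx'; have := fan_close (v := v) S C wy wy'.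
have := fan_close (v := v) S C wx wy'; have := fan_close (v := v) S C wy wx'.
have := dist0 _ vx; have := dist0 _ vy; have := dist0 _ vx'; have := dist0 _ vy'.
have := fanE _ wx; have := fanE _ wy; have := fanE _ wx'; have := fanE _ wy'.
move: e e'.
move: (fan X Y w v x) (fan X Y w v y) (fan X Y w v x') (fan X Y w v y').
move: (fdist X Y v w) (fdist X Y v x) (fdist X Y v y) (fdist X Y v x') (fdist X Y v y').
move=> W fx fy fx' fy' a b a' b' e e' hb' ha' hb ha fy0' fx0' fy0 fx0 yx' xy'' yy' xx' d' d.
have [h|h] : (absz (a' - a) < W /\ absz (b' - b) < W)%N \/
    (absz (b' - a) < W /\ absz (a' - b) < W)%N by lia.
- by left; split; [apply: xx'|apply: yy']; lia.
- by right; split; [apply: xy''|apply: yx']; lia.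
Qed.

(** * Sets of vertices closed under completing triangles *)

Section ClosedSets.

Variables (E : int -> int -> Prop) (B : int -> Prop) (S : strip E B).
Variables (K : option int -> Prop) (s t : int) (Bs : B s) (Bt : B t).

Definition in_window (x : option int) : Prop :=
  if x is Some p then s <= p /\ p <= t else True.

Hypothesis closed : forall x y z, triad E B x y z -> K x -> K y -> in_window z -> K z.

Lemma closed_below (p q z : int) : E p q -> s <= p -> q <= t ->
  K (Some p) -> K (Some q) -> p <= z -> z <= q -> K (Some z).
Proof.
have [k] : exists k : nat, q - p <= k%:Z by exists `|q - p|%N; lia.
elim: k p q => [|k IH] p q hk Epq sp qt Kp Kq pz zq; have pq := edge_lt S Epq; first by lia.
have [zp|[zq'|[pz' zq']]] : z = p \/ z = q \/ p < z /\ z < q by lia.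
- by rewrite zp.
- by rewrite zq'.
have [|x [px xq Epx Exq]] := triangle_below S Epq; first by lia.
have Kx : K (Some x).
  apply: (closed (x := Some p) (y := Some q)) => //=; last by lia.
  by split=> /=; [left|right|left].
by case: (leP z x) => zx; [apply: (IH p x)|apply: (IH x q)] => //; lia.
Qed.

(** Take the longest edge over (v, v + 1) in the window with both ends in K. A lower triangle above
    it would put a longer one in K, and the bridges at s and t keep that one inside the window; so
    the triangle above touches the upper boundary. *)
Lemma closed_bridge_edge (v : int) : s < v -> v < t -> K (Some v) -> K (Some (v + 1)) ->
  exists p q, [/\ E p q, s <= p, q <= t & [/\ B p, B q, K (Some p) & K (Some q)]].
Proof.
move=> sv vt Kv Kv1.
pose P d := exists p q, [/\ E p q, s <= p, q <= t, p <= v & v < q] /\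
  [/\ K (Some p), K (Some q) & d = q - p].
have [||d [[p [q [[Epq sp qt pv vq] [Kp Kq dE]]]] _ dmax]] := @int_max P 1 (t - s).
- exists v, (v + 1); split; first by split; [apply: (edge_succ S)|lia..].
  by split=> //; lia.
- by move=> d [p [q [[_ sp qt _ _] [_ _ ->]]]]; lia.
have pq := edge_lt S Epq.
exists p, q; split=> //.
have [[Bp Bq]|[r Epr Eqr]|[r Erp Erq]] := triangle_above S Epq.
- by [].
- have qr := edge_lt S Eqr.
  have rt : r <= t.
    by rewrite leNgt; apply/negP => tr; apply: (edge_bridge_nc S Epr Bt); lia.
  have Kr : K (Some r).
    apply: (closed (x := Some p) (y := Some q)) => //=; last by lia.
    by split=> /=; left.
  have /dmax : P (r - p) by exists p, r; split=> //; split=> //; lia.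
  by lia.
- have rp := edge_lt S Erp.
  have sr : s <= r.
    by rewrite leNgt; apply/negP => tr; apply: (edge_bridge_nc S Erq Bs); lia.
  have Kr : K (Some r).
    apply: (closed (x := Some p) (y := Some q)) => //=; last by lia.
    by split=> /=; [left|right|right].
  have /dmax : P (q - r) by exists r, q; split=> //; split=> //; lia.
  by lia.
Qed.

(** Membership spreads from foot to foot through the triangles formed by the upper point and two
    consecutive bridge feet. *)
Lemma closed_bridges (p : int) : K None -> B p -> K (Some p) -> s <= p -> p <= t ->
  forall b, B b -> s <= b -> b <= t -> K (Some b).
Proof.
move=> KN Bp Kp sp pt b Bb.
have [k] : exists k : nat, `|b - p| <= k%:Z by exists `|b - p|%N; lia.
elim: k b Bb => [|k IH] b Bb hk sb bt; first by have -> : b = p by lia.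
have [bp|pb|->//] := ltgtP b p.
- have [c [Ebc Bc cmin]] := next_bridge S Bb; have bc := edge_lt S Ebc.
  have cp := cmin p Bp bp.
  have Kc : K (Some c) by apply: IH => //; lia.
  apply: (closed (x := None) (y := Some c)) => //=.
  by split=> //=; right.
- have [c [Ebc Bc cmin]] := prev_bridge S Bb; have bc := edge_lt S Ebc.
  have cp := cmin p Bp pb.
  have Kc : K (Some c) by apply: IH => //; lia.
  apply: (closed (x := None) (y := Some c)) => //=.
  by split=> //=; left.
Qed.

(** Climb from (v, v + 1) to the upper boundary, move along it over the bridge feet, then descend
    below the edge between the two feet around z. *)
Lemma closed_window (v z : int) : s < v -> v < t -> K (Some v) -> K (Some (v + 1)) ->
  s <= z -> z <= t -> K (Some z).
Proof.
move=> sv vt Kv Kv1 sz zt.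
have [p [q [Epq sp qt [Bp Bq Kp Kq]]]] := closed_bridge_edge sv vt Kv Kv1.
have pq := edge_lt S Epq.
have KN : K None.
  by apply: (closed (x := Some p) (y := Some q)) => //; split=> //=; left.
have pt : p <= t by lia.
have Kb := closed_bridges KN Bp Kp sp pt.
have [b [c [Bb Bc Ebc bz zc]]] := bridge_interval z S.
have [->|zt'] : z = t \/ z < t by lia.
  by apply: Kb => //; lia.
have sb : s <= b.
  by rewrite leNgt; apply/negP => h; apply: (edge_bridge_nc S Ebc Bs); lia.
have ct : c <= t.
  by rewrite leNgt; apply/negP => h; apply: (edge_bridge_nc S Ebc Bt); lia.
by apply: (closed_below Ebc) => //; [apply: Kb => //; lia|apply: Kb => //; lia|lia].
Qed.

End ClosedSets.

(** * From periodic triangulations to collapsed strips *)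

Definition collapse (w : vertex) : option int := if w is Lower p then Some p else None.

Definition edge (T : set (vertex * vertex)) (p q : int) : Prop :=
  p < q /\ (q = p + 1 \/ T (Lower p, Lower q)).

(** Condition (A3) leaves a single possible upper end for an arc from p. *)
Definition bridge n (T : set (vertex * vertex)) (p : int) : Prop :=
  T (Lower p, Upper (superscript n p)).

Lemma superscript_le n p q : p <= q -> superscript n p <= superscript n q.
Proof.
move=> pq; case: n => [|n]; first by rewrite /superscript !divz0.
have : 0 < n.+1%:Z by [].
by rewrite /superscript; move: n.+1%:Z => N N0; nia.
Qed.

Lemma superscript_lower_vertex n i k : 1 <= i <= n%:Z -> superscript n (i + k * n%:Z) = k.
Proof.
move=> /andP[i1 iN]; rewrite /superscript addrAC addrC divzMDl; last by lia.
by rewrite divz_small ?addr0 //; lia.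
Qed.

Lemma arc_shape n e : is_arc n e ->
  (exists p q, [/\ e = (Lower p, Lower q), p < q & q <> p + 1]) \/
  exists p, e = (Lower p, Upper (superscript n p)).
Proof.
case: e => -[k|p] [l|q] /and4P[//= bef _ nn sup].
- by right; exists p; move/eqP: sup => ->.
- by left; exists p, q; split=> // qE; move: nn; rewrite qE; lia.
Qed.

(** Adding an uncrossed arc keeps the collection noncrossing, so by maximality the arc already
    belongs to it. *)
Lemma triangulation_max n T e : triangulation n T -> is_arc n e ->
  (forall f, T f -> ~~ crossing e f) -> T e.
Proof.
move=> [[arcs nc] maxT] ae ce.
have crC f g : crossing f g = crossing g f by rewrite /crossing orbC.
have cree : ~~ crossing e e.
  by case: e {ae ce} => -[k|p] [l|q]; rewrite /crossing /= ?ltxx ?andbF.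
have <- : T `|` [set e] = T.
  apply: maxT; last by move=> f Tf; left.
  split=> [f [/arcs//|->//]|f g [Tf|->] [Tg|->]] //.
  - exact: nc.
  - by rewrite crC ce.
  - exact: ce.
by right.
Qed.

Lemma edge_no_bridge n T p q r : triangulation n T -> edge T p q -> bridge n T r ->
  p < r -> r < q -> False.
Proof.
move=> [[_ nc] _] [pq [qE|Tpq]] Tr pr rq; first by lia.
by have := nc _ _ Tpq Tr; rewrite /crossing /= pr rq.
Qed.

Lemma edge_noncrossing n T p q r s : triangulation n T -> edge T p q -> edge T r s ->
  p < r -> r < q -> q < s -> False.
Proof.
move=> [[_ nc] _] [pq [qE|Tpq]] [rs [sE|Trs]] pr rq qs; try lia.
by have := nc _ _ Tpq Trs; rewrite /crossing /= pr rq qs.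
Qed.

Lemma bridge_per n T (k : int) : (1 <= n)%N -> periodic_triangulation n T ->
  exists2 p, superscript n p = k & bridge n T p.
Proof.
move=> n1 [_ [i [k0 [ik Tl _ TE]]]].
exists (i + k * n%:Z); first exact: superscript_lower_vertex.
rewrite /bridge superscript_lower_vertex // TE.
(* The left side of the fundamental domain, translated by k - k0 periods. *)
exists (k - k0), (lower_vertex n i k0, Upper k0); split=> //=.
- by rewrite lexx /=; nia.
- by rewrite eqxx.
- by congr (Lower _, Upper _); rewrite ?mulrBl; lia.
Qed.

(** The two maximality clauses come from [triangulation_max]; bridges on both sides of a vertex come
    from periodicity through [bridge_per]. *)
Lemma strip_of_triangulation n T : (1 <= n)%N -> periodic_triangulation n T ->
  strip (edge T) (bridge n T).
Proof.
move=> n1 pT; have [tT _] := pT; have [[arcs nc] _] := tT.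
split.
- by move=> p q [].
- by move=> p; split; [lia|left].
- by move=> p q r s; apply: edge_noncrossing tT.
- by move=> p q r; apply: edge_no_bridge tT.
- move=> p q pq c1 c2 cB; split=> //.
  have [->|qp] := eqVneq q (p + 1); [by left|right].
  apply: (triangulation_max tT) => [|f Tf]; first by rewrite /is_arc /= pq /=; lia.
  have [[r [s [fE rs sr]]]|[r fE]] := arc_shape (arcs _ Tf).
  + have Ers : edge T r s by split=> //; right; rewrite -fE.
    rewrite fE /crossing /=; apply/negP => /orP[] /and3P[h1 h2 h3].
    * exact: (c1 r s).
    * exact: (c2 r s).
  + rewrite fE /crossing /= andbT andbF orbF; apply/negP => /andP[h1 h2].
    by apply: (cB r) => //; rewrite /bridge -fE.
- move=> p c; apply: (triangulation_max tT) => [|f Tf]; first by rewrite /is_arc /= eqxx.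
  have [[r [s [fE rs sr]]]|[r fE]] := arc_shape (arcs _ Tf).
  + have Ers : edge T r s by split=> //; right; rewrite -fE.
    rewrite fE /crossing /= andbF /=; apply/negP => /and3P[h1 h2 _].
    exact: (c r s).
  + rewrite fE /crossing /=; apply/negP => /orP[] /andP[/ltW/(superscript_le n)].
    * by lia.
    * by lia.
- move=> p; have [q qE Bq] := bridge_per (superscript n p - 1) n1 pT.
  exists q => //; rewrite ltNge; apply/negP => /(superscript_le n).
  by rewrite qE; lia.
- move=> p; have [q qE Bq] := bridge_per (superscript n p + 1) n1 pT.
  exists q => //; rewrite ltNge; apply/negP => /(superscript_le n).
  by rewrite qE; lia.
Qed.

(** An edge cannot pass over the bridge with the next superscript. The two outcomes separate
    three-sided from four-sided triangles at the upper boundary. *)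
Lemma superscript_next_bridge n T p q : (1 <= n)%N -> periodic_triangulation n T ->
  edge T p q -> superscript n q = superscript n p \/ superscript n q = superscript n p + 1.
Proof.
move=> n1 pT Epq; have [tT _] := pT; have pq := edge_lt (strip_of_triangulation n1 pT) Epq.
have := superscript_le n (ltW pq).
have [r rE Br] := bridge_per (superscript n p + 1) n1 pT.
have [qr|rq] := ltP q (r + 1).
  have : q <= r by lia.
  by move/(superscript_le n); lia.
have pr : p < r by rewrite ltNge; apply/negP => /(superscript_le n); lia.
have [->|qr] := eqVneq q r; first by lia.
by case: (edge_no_bridge tT Epq Br pr); lia.
Qed.

Lemma joined_sym T x y : joined T x y -> joined T y x.
Proof.
case=> [h|h|h]; [constructor 1|by constructor 3|by constructor 2].
by case: x y h => [k|p] [l|q] //=; lia.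
Qed.

Lemma joined_lower n T p q : noncrossing_arcs n T ->
  joined T (Lower p) (Lower q) <-> edge T p q \/ edge T q p.
Proof.
move=> [arcs _]; split=> [[/= h|h|h]|[[pq [->|h]]|[qp [->|h]]]].
- by case: (ltP p q) => pq; [left|right]; split; try left; lia.
- by left; split; [have /and4P[] := arcs _ h|right].
- by right; split; [have /and4P[] := arcs _ h|right].
- by constructor 1 => /=; lia.
- by constructor 2.
- by constructor 1 => /=; lia.
- by constructor 3.
Qed.

Lemma joined_upper n T p k : noncrossing_arcs n T ->
  joined T (Lower p) (Upper k) <-> k = superscript n p /\ bridge n T p.
Proof.
move=> [arcs _]; split=> [[//|h|h]|[-> h]]; last by constructor 2.
- by have /and4P[_ _ _ /eqP e] := arcs _ h; split=> //; rewrite /bridge e.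
- by have /and4P[] := arcs _ h.
Qed.

Lemma joined_adj n T x y : noncrossing_arcs n T -> joined T x y ->
  is_lower x || is_lower y -> adj (edge T) (bridge n T) (collapse x) (collapse y).
Proof.
move=> ncT; case: x y => [k|p] [l|q] //= + _.
- by move/joined_sym/(joined_upper _ _ ncT) => [].
- by move/(joined_upper _ _ ncT) => [].
- by move/(joined_lower _ _ ncT).
Qed.

Lemma joined_upperxx n T k : noncrossing_arcs n T -> ~ joined T (Upper k) (Upper k).
Proof.
move=> [arcs _] [/=|h|h]; first by rewrite subrr normr0.
- by have /and4P[/=] := arcs _ h; rewrite ltxx.
- by have /and4P[/=] := arcs _ h; rewrite ltxx.
Qed.

(** * Triangles at a lower vertex and their number *)

(** Undoes the collapse: [None] lifts to the upper vertices whose superscripts occur among the lower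
    vertices of the triangle, which gives two of them exactly in the four-sided case. *)
Definition vertices_of n (x y z : option int) : set vertex := [set w |
  match w with
  | Lower q => Some q \in [:: x; y; z]
  | Upper k => None \in [:: x; y; z] /\
      exists2 q, Some q \in [:: x; y; z] & superscript n q = k
  end].

Lemma vertices_of_perm n x y z x' y' z' : [:: x; y; z] =i [:: x'; y'; z'] ->
  vertices_of n x y z = vertices_of n x' y' z'.
Proof.
by move=> e; apply/seteqP; split=> -[k|p] /=; rewrite ?e //; case=> ? [q];
   rewrite ?e => *; split=> //; exists q; rewrite ?e // -?e.
Qed.

Lemma vertices_of_collapse n p z z' o :
  o \in [:: Some p; z; z'] <-> exists2 w, vertices_of n (Some p) z z' w & collapse w = o.
Proof.
split=> [oin|[w]].
  case: o oin => [q|] oin; first by exists (Lower q).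
  exists (Upper (superscript n p)) => //=; split=> //.
  by exists p => //; rewrite inE eqxx.
by case: w => [k|q] /= + <- //; case.
Qed.

Lemma vertices_of_inj n p z z' y y' : vertices_of n (Some p) z z' = vertices_of n (Some p) y y' ->
  [:: Some p; z; z'] =i [:: Some p; y; y'].
Proof.
move=> e o; apply/idP/idP => /(vertices_of_collapse n); [rewrite e|rewrite -e].
- by move/vertices_of_collapse.
- by move/vertices_of_collapse.
Qed.

Lemma bridged_edge_triangle n T p q : (1 <= n)%N -> periodic_triangulation n T ->
  edge T p q -> bridge n T p -> bridge n T q ->
  triangle T (vertices_of n (Some p) (Some q) None) /\
  (three_sided T (Lower p) (Lower q) (Upper (superscript n p)) \/
   four_sided T p q (superscript n p)).
Proof.
move=> n1 pT Epq Bp Bq; have ncT := pT.1.1.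
have jpq : joined T (Lower p) (Lower q) by apply/(joined_lower _ _ ncT); left.
have jp : joined T (Lower p) (Upper (superscript n p)) by apply/(joined_upper _ _ ncT).
have jq : joined T (Lower q) (Upper (superscript n q)) by apply/(joined_upper _ _ ncT).
have [e|e] := superscript_next_bridge n1 pT Epq; rewrite e in jq.
- have t3 : three_sided T (Lower p) (Lower q) (Upper (superscript n p)) by split.
  split; last by left.
  left; exists (Lower p), (Lower q), (Upper (superscript n p)); split=> //.
  apply/seteqP; split=> -[k|r] /=; rewrite ?inE.
  + by case=> _ [r]; rewrite !inE orbF => /orP[] /eqP[->] <-; right; rewrite ?e.
  + by rewrite orbF => /orP[] /eqP[->]; left; [left|right].
  + case=> [[]//|[->]]; split=> //; exists p => //.
    by rewrite inE eqxx.
  + by case=> [[] [->]|//]; rewrite eqxx ?orbT.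
- have t4 : four_sided T p q (superscript n p) by split.
  split; last by right.
  right; exists p, q, (superscript n p); split=> //.
  apply/seteqP; split=> -[k|r] /=; rewrite ?inE.
  + by case=> _ [r]; rewrite !inE orbF => /orP[] /eqP[->] <-;
      [left; right|right; rewrite e].
  + by rewrite orbF => /orP[] /eqP[->]; left; left; [left|right].
  + case=> [[[]//|[->]]|[->]]; split=> //; [exists p|exists q] => //.
    * by rewrite inE eqxx.
    * by rewrite !inE eqxx orbT.
  + by case=> [[[] [->]|//]|//]; rewrite eqxx ?orbT.
Qed.

Lemma triangle_vertices_of n T p z z' : (1 <= n)%N -> periodic_triangulation n T ->
  triad (edge T) (bridge n T) (Some p) z z' -> triangle T (vertices_of n (Some p) z z').
Proof.
move=> n1 pT; have ncT := pT.1.1.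
have up q : triad (edge T) (bridge n T) (Some p) (Some q) None ->
    triangle T (vertices_of n (Some p) (Some q) None).
  case=> /= -[Epq|Eqp] Bq Bp; first by have [] := bridged_edge_triangle n1 pT Epq Bp Bq.
  have [+ _] := bridged_edge_triangle n1 pT Eqp Bq Bp.
  by congr (triangle T _); apply: vertices_of_perm => o; rewrite !inE orbCA.
case: z z' => [q|] [r|] tr.
- left; exists (Lower p), (Lower q), (Lower r); case: tr => pq qr pr.
  split; first by split; apply/(joined_lower _ _ ncT).
  apply/seteqP; split=> -[k|s] /=; rewrite ?inE.
  + by case.
  + by move=> /or3P[] /eqP[->]; [left; left|left; right|right].
  + by case=> [[]|].
  + by case=> [[]|] [->]; rewrite eqxx ?orbT.
- exact: up.
- rewrite (@vertices_of_perm n _ _ _ (Some p) (Some r) None).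
    by apply: up; case: tr => *; split=> //.
  by move=> o; rewrite !inE [(o == None) || _]orbC.
- by case: tr.
Qed.

Lemma vertices_of_triangle n T p t : (1 <= n)%N -> periodic_triangulation n T ->
  triangle T t -> t (Lower p) -> exists z z',
    triad (edge T) (bridge n T) (Some p) z z' /\ t = vertices_of n (Some p) z z'.
Proof.
move=> n1 pT; have ncT := pT.1.1; have S := strip_of_triangulation n1 pT.
have three b c : three_sided T (Lower p) b c -> exists z z',
    triad (edge T) (bridge n T) (Some p) z z' /\
    [set Lower p; b; c] = vertices_of n (Some p) z z'.
  have up q k : three_sided T (Lower p) (Lower q) (Upper k) -> exists z z',
      triad (edge T) (bridge n T) (Some p) z z' /\
      [set Lower p; Lower q; Upper k] = vertices_of n (Some p) z z'.
    case=> /(joined_lower _ _ ncT) pq /(joined_upper _ _ ncT)[kq Bq].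
    move=> /(joined_upper _ _ ncT)[kp Bp].
    exists (Some q), None; split=> //.
    apply/seteqP; split=> -[l|r] /=; rewrite ?inE.
    + case=> [[]//|[->]]; split=> //; exists p => //.
      by rewrite inE eqxx.
    + by case=> [[] [->]|//]; rewrite eqxx ?orbT.
    + by case=> _ [r]; rewrite !inE orbF => /orP[] /eqP[->] <-; right; rewrite -?kp -?kq.
    + by rewrite orbF => /orP[] /eqP[->]; left; [left|right].
  case: b c => [k|q] [l|r] h.
  (* Both upper vertices carry the superscript of p, so they coincide and cannot be joined. *)
  - case: h => /(joined_upper _ _ ncT)[kE _] + /(joined_upper _ _ ncT)[lE _].
    by rewrite kE lE => /(joined_upperxx ncT).
  - have [|z [z' [tr e]]] := up r k.
      by case: h => pk kr pr; split=> //; apply: joined_sym.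
    by exists z, z'; rewrite -e; split=> //; rewrite -!setUA [[set Upper k] `|` _]setUC.
  - exact: up.
  - case: h => /(joined_lower _ _ ncT) pq /(joined_lower _ _ ncT) qr.
    move=> /(joined_lower _ _ ncT) pr.
    exists (Some q), (Some r); split=> //.
    apply/seteqP; split=> -[k|s] /=; rewrite ?inE.
    + by case=> [[]|].
    + by case=> [[]|] [->]; rewrite eqxx ?orbT.
    + by case.
    + by move=> /or3P[] /eqP[->]; [left; left|left; right|right].
case=> [[a [b [c [[ab bc ac] ->]]]]|[a [b [k [[ab ak bk] ->]]]]].
- move=> [[] /= e|/= e]; subst.
  + by apply: three.
  + have [|z [z' [tr e]]] := three a c; first by split=> //; apply: joined_sym.
    by exists z, z'; rewrite -e; split=> //; rewrite [[set a] `|` _]setUC.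
  + have [|z [z' [tr e]]] := three a b; first by split=> //; apply: joined_sym.
    by exists z, z'; rewrite -e; split=> //; rewrite [LHS]setUC setUA.
- move: ab ak bk => /(joined_lower _ _ ncT) ab /(joined_upper _ _ ncT)[ka Ba].
  move=> /(joined_upper _ _ ncT)[kb Bb].
  have tE : [set Lower a; Lower b; Upper k; Upper (k + 1)] =
      vertices_of n (Some a) (Some b) None.
    apply/seteqP; split=> -[l|r] /=; rewrite ?inE.
    + case=> [[[]//|[->]]|[->]]; split=> //; [exists a|exists b] => //.
      * by rewrite inE eqxx.
      * by rewrite !inE eqxx orbT.
    + by case=> [[[] [->]|//]|//]; rewrite eqxx ?orbT.
    + by case=> _ [r]; rewrite !inE orbF => /orP[] /eqP[->] <-;
        [left; right; rewrite ka|right; rewrite kb].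
    + by rewrite orbF => /orP[] /eqP[->]; left; left; [left|right].
  move=> tp; have pab : p = a \/ p = b by case: tp => [[[] [->]|//]|//]; [left|right].
  rewrite tE; case: pab => ->.
  + by exists (Some b), None.
  + exists (Some a), None; split; first by split=> //; apply: adj_sym.
    by apply: vertices_of_perm => o; rewrite !inE orbCA.
Qed.

Lemma fdist_lt E B X Y (p q : int) : strip E B -> coordinates E B X Y -> p < q ->
  (fdist X Y (Some p) (Some q))%:Z = pdet X Y (Some p) (Some q).
Proof. by move=> S C pq; rewrite /fdist gtz0_abs // (pdet_gt0 S C). Qed.

(** A triangle at p corresponds to a gap between fan coordinates s and s + 1, and these coordinates
    run from 0 at p + 1 to det(u_{p-1}, u_{p+1}) at p - 1. *)
Lemma card_triangles n T X Y p : (1 <= n)%N -> periodic_triangulation n T ->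
  coordinates (edge T) (bridge n T) X Y ->
  [set t | triangle T t /\ t (Lower p)] #= `I_(fdist X Y (Some (p - 1)%R) (Some (p + 1)%R)).
Proof.
move=> n1 pT C; have S := strip_of_triangulation n1 pT.
pose r := fdist X Y (Some (p - 1)) (Some (p + 1)).
have rE : pdet X Y (Some (p - 1)) (Some (p + 1)) = r%:Z.
  by rewrite (fdist_lt S C) //; lia.
pose c := fan_succ X Y p.
pose R t (s : nat) := exists z z', [/\ triad (edge T) (bridge n T) (Some p) z z',
  t = vertices_of n (Some p) z z', c z = s%:Z & c z' = s%:Z + 1].
have Rfun t s s' : R t s -> R t s' -> s = s'.
  move=> [z [z' [[pz zz' pz'] -> cz cz']]] [y [y' [[py yy' py'] /vertices_of_inj e cy cy']]].
  (* The vertex set determines the unordered pair of other vertices, and the larger fan coordinate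
     orders it. *)
  have /= := e z; have /= := e z'; rewrite !inE !eqxx ?orbT.
  have np x : adj (edge T) (bridge n T) (Some p) x -> (x == Some p) = false.
    by move=> px; apply/eqP => xp; rewrite xp in px; apply: (adj_irr S px).
  rewrite !np // => /esym/= /orP[]/eqP ez' /esym/= /orP[]/eqP ez; subst; lia.
have Rinj t t' s : R t s -> R t' s -> t = t'.
  move=> [z [z' [[pz zz' pz'] -> cz cz']]] [y [y' [[py yy' py'] -> cy cy']]].
  have pp1 : Some p <> Some (p + 1) by case; lia.
  have -> : z = y by apply: (fan_inj S C pz py pp1); rewrite -/(fan_succ _ _ _ _) -/c cz.
  by have -> : z' = y' by apply: (fan_inj S C pz' py' pp1); rewrite -/(fan_succ _ _ _ _) -/c cz'.
have Rex t : triangle T t -> t (Lower p) -> exists2 s, (s < r)%N & R t s.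
  move=> tt tp; have [z [z' [tr tE]]] := vertices_of_triangle n1 pT tt tp.
  have main y y' : triad (edge T) (bridge n T) (Some p) y y' -> c y' = c y + 1 ->
      exists2 s, (s < r)%N & R (vertices_of n (Some p) y y') s.
    move=> try e; case: (try) => py _ py'.
    have y0 := fan_succ_ge0 S C py; exists (absz (c y)).
      have lt1 : y' = Some (p - 1) \/ fan_succ X Y p y' < fan_succ X Y p (Some (p - 1)).
        by have [->|/eqP y'p] := eqVneq y' (Some (p - 1)); [left|right; apply: fan_succ_lt C py' y'p].
      have : c y' <= r%:Z.
        by case: lt1 => [->|]; rewrite /c -rE -(fan_succ_pred p S C); lia.
      by rewrite -/(c y) in y0; lia.
    by exists y, y'; split=> //; rewrite -/(c y) in y0; lia.
  rewrite tE; case: (triad_fan_succ S C tr) => e; first exact: main.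
  have -> : vertices_of n (Some p) z z' = vertices_of n (Some p) z' z.
    by apply: vertices_of_perm => o; rewrite !inE [(o == z) || _]orbC.
  by apply: main => //; case: tr => pz zz' pz'; split=> //; apply: adj_sym.
(* By [Rex] and [Rfun] each triangle at p has exactly one s, so the default 0 is never taken for
   want of a value. *)
apply/card_set_bijP; exists (fun t => xget 0%N [set s | R t s]).
have getE t s : R t s -> xget 0%N [set s | R t s] = s.
  by move=> Rts; apply: xget_unique => // y Rty; apply: Rfun Rty Rts.
split.
- by move=> t [tt tp] /=; have [s sr /getE ->] := Rex t tt tp.
- move=> t t'; rewrite !inE => -[tt tp] [tt' tp'].
  have [s _ Rs] := Rex t tt tp; have [s' _ Rs'] := Rex t' tt' tp'.
  by rewrite (getE _ _ Rs) (getE _ _ Rs') => e; rewrite e in Rs; apply: Rinj Rs Rs'.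
- move=> s /= sr; have [|z [z' [tr cz cz']]] := @fan_succ_surj _ _ _ _ p s S C.
    by rewrite rE; rewrite -/r in sr; lia.
  have Rs : R (vertices_of n (Some p) z z') s by exists z, z'.
  exists (vertices_of n (Some p) z z'); last exact: getE.
  by split; [apply: triangle_vertices_of|rewrite /= inE eqxx].
Qed.

(** * Frieze entries as determinants *)

Lemma periodic_friezeM n m (i j k : int) : periodic_frieze n m -> i <= j ->
  m (i + k * n%:Z) (j + k * n%:Z) = m i j.
Proof.
move=> mper ij.
have pos (l : nat) i' j' : i' <= j' -> m (i' + l%:Z * n%:Z) (j' + l%:Z * n%:Z) = m i' j'.
  move=> ij'; elim: l => [|l IH]; first by rewrite mul0r !addr0.
  by rewrite -IH [RHS]mper; [congr (m _ _); lia|lia].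
case: k => [k|k]; first exact: pos.
rewrite -(pos k.+1) ?NegzE; last by lia.
by congr (m _ _); lia.
Qed.

Lemma frieze_pdet n T m X Y i j : (1 <= n)%N -> periodic_triangulation n T ->
  coordinates (edge T) (bridge n T) X Y -> associated_frieze n T m ->
  -2 <= j - i -> m i j = pdet X Y (Some (i - 1)) (Some (j + 1)).
Proof.
move=> n1 pT C [[m0 m1 mpos muni] mper [a [qa ma]]] ij.
have S := strip_of_triangulation n1 pT.
have diag p : m p p = pdet X Y (Some (p - 1)) (Some (p + 1)).
  (* The quiddity sequence is indexed by 1, ..., n, so p is written as i0^(k) and the entry is moved
     back by k periods. *)
  pose k := superscript n p; pose i0 := p - k * n%:Z.
  have i0n : 1 <= i0 <= n%:Z.
    rewrite /i0 /k /superscript; have := divz_eq (p - 1) n%:Z.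
    have n0 : n%:Z != 0 by lia.
    by have := modz_ge0 (p - 1) n0; have := ltz_mod (p - 1) n0; lia.
  have pE : lower_vertex n i0 k = Lower p by rewrite /lower_vertex /i0 subrK.
  have := qa i0 k i0n; rewrite pE => /card_esym/card_eq_trans.
  move/(_ _ _ (card_triangles p n1 pT C))/card_eq_II => aE.
  rewrite -(fdist_lt S C) -?aE; last by lia.
  by rewrite -ma // -[RHS](periodic_friezeM k mper) // /i0 subrK.
have [k kE] : exists k : nat, j = i - 2 + k%:Z by exists (absz (j - i + 2)); lia.
elim/ltn_ind: k i j ij kE => -[|[|[|k]]] IH i j _ ->.
- by rewrite addr0 m0 (_ : i - 2 + 1 = i - 1) ?pdetxx //; lia.
- rewrite (_ : i - 2 + 1%N%:Z = i - 1) ?m1; last by lia.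
  by rewrite subrK -{2}[i](subrK 1) (pdet_edge C (edge_succ S _)).
- by rewrite (_ : i - 2 + 2%N%:Z = i) ?diag //; lia.
(* The unimodular rule at (i, j') and the Pluecker relation for i - 1, i, j' + 1, j' + 2 have the
   same shape. Both are solved for the new entry, whose coefficient det(u_i, u_{j'+1}) is
   positive. *)
- set j' := i + k%:Z.
  have -> : i - 2 + k.+3%:Z = j' + 1 by rewrite /j'; lia.
  have ij' : i < j' + 1 by rewrite /j'; lia.
  have rule : m i j' * m (i + 1) (j' + 1) - m (i + 1) j' * m i (j' + 1) = 1.
    by apply: muni; lia.
  have IHj p q : p + k%:Z <= q + 1 -> q <= p + k%:Z -> m p q = pdet X Y (Some (p - 1)) (Some (q + 1)).
    by move=> pq qp; apply: (IH (absz (q - p + 2)%R)); lia.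
  have := plucker X Y (Some (i - 1)) (Some i) (Some (j' + 1)) (Some (j' + 1 + 1)).
  have := pdet_edge C (edge_succ S (i - 1)); rewrite subrK => ->.
  rewrite (pdet_edge C (edge_succ S (j' + 1))) mul1r => pl.
  rewrite (IHj i j') ?(IHj (i + 1) (j' + 1)) ?(IHj (i + 1) j') ?addrK in rule; try lia.
  have pos := pdet_gt0 S C ij'.
  pose d (p q : int) := pdet X Y (Some p) (Some q).
  have dE p q : pdet X Y (Some p) (Some q) = d p q by [].
  rewrite !dE in rule pl pos *.
  by apply: (mulfI (lt0r_neq0 pos)); lia.
Qed.

(** * The labeling procedure computes absolute determinants *)

Section Labels.

Variables (n : nat) (T : set (vertex * vertex)).
Hypotheses (n1 : (1 <= n)%N) (pT : periodic_triangulation n T).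
Variables (X Y : int -> int) (C : coordinates (edge T) (bridge n T) X Y).
Variable v : int.

Let ncT : noncrossing_arcs n T := pT.1.1.
Let S : strip (edge T) (bridge n T) := strip_of_triangulation n1 pT.
Local Notation adjT := (adj (edge T) (bridge n T)).
Local Notation triadT := (triad (edge T) (bridge n T)).
Local Notation F w := (fdist X Y (Some v) (collapse w)).

Lemma same_label_collapse u w : same_label u w = (collapse u == collapse w).
Proof.
case: u w => [k|p] [l|q]; rewrite /same_label /=.
- by rewrite orbT.
- by [].
- by [].
- by rewrite orbF; apply/eqP/eqP => -[->].
Qed.

Lemma upper_triangle_triad w1 w2 w3 : upper_triangle T w1 w2 w3 ->
  triadT (collapse w1) (collapse w2) (collapse w3).
Proof.
move=> [p [q [k [sides pe]]]].
have [pq [pU qU]] : adjT (Some p) (Some q) /\ adjT (Some p) None /\ adjT (Some q) None.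
  by case: sides => -[pq]; [move=> qk pk|move=> pk qk]; split; try split;
    apply: (joined_adj ncT pq) || apply: (joined_adj ncT pk) || apply: (joined_adj ncT qk).
pose s := [:: Lower p; Lower q; Upper k].
(* Pairwise adjacency does not depend on the order of the vertices, which handles all permutations
   at once. *)
have adjs w w' : w \in s -> w' \in s -> w != w' -> adjT (collapse w) (collapse w').
  by rewrite !inE => /or3P[] /eqP-> /or3P[] /eqP-> //; rewrite ?eqxx // => _;
    apply: adj_sym.
have : uniq [:: w1; w2; w3].
  have pqN : Lower p != Lower q.
    by apply/eqP => -[pE]; rewrite pE in pq; apply: (adj_irr S pq).
  by rewrite (perm_uniq pe) /= !inE negb_or pqN.
rewrite /= !inE !andbT negb_or => /andP[/andP[n12 n13] n23].
have mem w : w \in [:: w1; w2; w3] -> w \in s by rewrite (perm_mem pe).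
by split; apply: adjs => //; apply: mem; rewrite !inE eqxx ?orbT.
Qed.

Lemma lower_triangle_triad w1 w2 w3 : lower_triangle T w1 w2 w3 ->
  triadT (collapse w1) (collapse w2) (collapse w3).
Proof.
by case=> l1 l2 l3 [j12 j23 j13]; split; apply: (joined_adj ncT) => //; rewrite ?l1 ?l2.
Qed.

Lemma triad_realized x y z : triadT x y z -> exists w1 w2 w3,
  [/\ collapse w1 = x, collapse w2 = y, collapse w3 = z &
    lower_triangle T w1 w2 w3 \/ upper_triangle T w1 w2 w3].
Proof.
have up p q : triadT (Some p) (Some q) None -> exists k,
    forall w1 w2 w3, perm_eq [:: w1; w2; w3] [:: Lower p; Lower q; Upper k] ->
    upper_triangle T w1 w2 w3.
  case=> /= -[Epq|Eqp] Bq Bp.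
  - have [_ sides] := bridged_edge_triangle n1 pT Epq Bp Bq.
    by exists (superscript n p) => w1 w2 w3 pe; exists p, q, (superscript n p).
  - have [_ sides] := bridged_edge_triangle n1 pT Eqp Bq Bp.
    exists (superscript n q) => w1 w2 w3 pe; exists q, p, (superscript n q); split=> //.
    by apply: perm_trans pe _; rewrite (perm_catCA [:: Lower p] [:: Lower q]).
case: x y z => [p|] [q|] [r|] tr.
- exists (Lower p), (Lower q), (Lower r); split=> //; left; split=> //.
  by case: tr => pq qr pr; split; apply/(joined_lower _ _ ncT).
- have [k kP] := up p q tr; exists (Lower p), (Lower q), (Upper k).
  by split=> //; right; apply: kP.
- have [k kP] := up p r (triad_swap (triad_rot (triad_rot tr))).
  exists (Lower p), (Upper k), (Lower r); split=> //; right; apply: kP.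
  by rewrite perm_cons (perm_catC [:: Upper k]).
- by case: tr.
- have [k kP] := up q r (triad_rot tr).
  exists (Upper k), (Lower q), (Lower r); split=> //; right; apply: kP.
  by rewrite (perm_catC [:: Upper k]).
- by case: tr.
- by case: tr.
- by case: tr.
Qed.

Lemma initial_labels_collapse w : initial_labels T (Lower v) w =
  if collapse w == Some v then Some 0%N
  else if `[< adjT (Some v) (collapse w) >] then Some 1%N else None.
Proof.
rewrite /initial_labels; have -> : (w == Lower v) = (collapse w == Some v).
  by case: w => [k|p] /=; apply/eqP/eqP => // -[->].
case: (_ == _) => //; rewrite (@asbool_equiv_eq _ (adjT (Some v) (collapse w))) //.
split=> [[u]|].
- rewrite same_label_collapse => /eqP <- jvu.
  exact: (joined_adj ncT jvu).
- case: w => [k|p] /= h.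
  + exists (Upper (superscript n v)) => //; first by rewrite /same_label orbT.
    by apply/(joined_upper _ _ ncT).
  + exists (Lower p); first by rewrite /same_label eqxx.
    by apply/(joined_lower _ _ ncT).
Qed.

(* Closure under parents forces every completed triangle to be completed at its
   vertex farthest from v, where the label is the sum of the two others. *)
Record label_inv (L : vertex -> option nat) : Prop := LabelInv {
  label_inv_collapse : forall u w, collapse u = collapse w -> L u = L w;
  label_inv_value : forall w x, L w = Some x -> x = F w;
  label_inv_parent : forall w x y, L w <> None ->
    triadT (collapse w) (collapse x) (collapse y) -> F w = (F x + F y)%N ->
    L x <> None /\ L y <> None;
  label_inv_start : L (Lower v) <> None;
  label_inv_adj : forall w, adjT (Some v) (collapse w) -> L w <> None }.

Lemma fdist_eq0 w : F w = 0%N -> collapse w = Some v.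
Proof.
by move=> F0; apply/esym/(pdet_eq0 S C)/eqP; rewrite -absz_eq0; apply/eqP.
Qed.

Lemma initial_label_inv : label_inv (initial_labels T (Lower v)).
Proof.
have start w : adjT (Some v) (collapse w) -> initial_labels T (Lower v) w <> None.
  by move=> a; rewrite initial_labels_collapse asboolT //; case: ifP.
have self w : collapse w = Some v -> initial_labels T (Lower v) w <> None.
  by move=> e; rewrite initial_labels_collapse e eqxx.
split=> //.
- by move=> u w e; rewrite !initial_labels_collapse e.
- move=> w x; rewrite initial_labels_collapse; case: eqP => [-> [<-]|_].
    by rewrite /fdist pdetxx.
  by case: asboolP => // a [<-]; rewrite /fdist; case: (pdet_adj C a) => ->.
- move=> w x y; rewrite initial_labels_collapse => Lw [wx xy wy] Fw.
  (* A vertex labeled at the start is at distance at most 1, so one of its parents is v itself and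
     the other is adjacent to v. *)
  have : (F w <= 1)%N.
    case: eqP Lw => [-> _|_]; first by rewrite /fdist pdetxx.
    by case: asboolP => // a _; rewrite /fdist; case: (pdet_adj C a) => ->.
  rewrite Fw => le1; have [x0|y0] : F x = 0%N \/ F y = 0%N by lia.
  + have xv := fdist_eq0 x0; rewrite xv in xy.
    by split; [apply: self|apply: start].
  + have yv := fdist_eq0 y0; rewrite yv in xy.
    by split; [apply: start; apply: adj_sym|apply: self].
- exact: self.
Qed.

(** If w1 or w2 were the farthest vertex from v in the triangle, w would be one of its parents and
    already labeled. Hence w is the farthest, and by [parents_uniq] w1 and w2 are its only
    parents. *)
Lemma set_label_inv L w w1 w2 x1 x2 : label_inv L ->
  triadT (collapse w1) (collapse w2) (collapse w) ->
  L w1 = Some x1 -> L w2 = Some x2 -> L w = None ->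
  label_inv (set_label L w (x1 + x2)).
Proof.
move=> [Lc Lv Lp Ls La] tr L1 L2 Lw.
have Fw : F w = (F w1 + F w2)%N.
  have [e|e|//] := triad_fdist (Some v) C tr.
  - by case: (Lp w1 w2 w) => //; rewrite L1.
  - by case: (Lp w2 w1 w) => //; [rewrite L2|apply: triad_swap].
have mono u : L u <> None -> set_label L w (x1 + x2) u <> None.
  by rewrite /set_label; case: ifP.
(* All neighbors of v are labeled at the start, so v is not a neighbor of the unlabeled w;
   [parents_uniq] asks for this. *)
have nv u : adjT (collapse w) (collapse u) -> Some v <> collapse u.
  by move=> wu vu; case: (La w) => //; rewrite vu; apply: adj_sym.
split.
- by move=> u u' e; rewrite /set_label !same_label_collapse e (Lc _ _ e).
- move=> u x; rewrite /set_label same_label_collapse; case: eqP => [-> [<-]|_]; last exact: Lv.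
  by rewrite (Lv _ _ L1) (Lv _ _ L2).
- move=> u x y; rewrite {1}/set_label same_label_collapse; case: eqP => [->|_ Lu tr' Fu].
  + move=> _ trw Fw'; have trw0 := triad_rot (triad_rot tr).
    have [|[ex ey]|[ex ey]] := parents_uniq S C trw0 trw Fw Fw'.
    * by case: trw trw0 => wx _ wy [ww1 _ ww2]; split; apply: nv.
    * by split; apply: mono; [rewrite -(Lc _ _ ex) L1|rewrite -(Lc _ _ ey) L2].
    * by split; apply: mono; [rewrite -(Lc _ _ ey) L2|rewrite -(Lc _ _ ex) L1].
  + by have [Lx Ly] := Lp _ _ _ Lu tr' Fu; split; apply: mono.
- exact: mono.
- by move=> u /La; apply: mono.
Qed.

Lemma completes_triad L w x :
  completes (lower_triangle T) L w x \/ completes (upper_triangle T) L w x ->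
  exists w1 w2 x1 x2, [/\ triadT (collapse w1) (collapse w2) (collapse w),
    L w1 = Some x1, L w2 = Some x2, L w = None & x = (x1 + x2)%N].
Proof.
by case=> -[w1 [w2 [x1 [x2 [tr L1 L2 Lw xE]]]]]; exists w1, w2, x1, x2; split=> //;
  [apply: lower_triangle_triad|apply: upper_triangle_triad].
Qed.

Lemma reachable_inv L : reachable T (Lower v) L -> label_inv L.
Proof.
elim=> {L} [|L w x _ IH comp|L w x _ IH _ comp]; first exact: initial_label_inv.
- have [|w1 [w2 [x1 [x2 [tr L1 L2 Lw ->]]]]] := @completes_triad L w x; first by left.
  exact: set_label_inv tr L1 L2 Lw.
- have [|w1 [w2 [x1 [x2 [tr L1 L2 Lw ->]]]]] := @completes_triad L w x; first by right.
  exact: set_label_inv tr L1 L2 Lw.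
Qed.

(** * Saturation inside a finite window *)

Section Window.

Variables (s t : int) (Bs : bridge n T s) (Bt : bridge n T t).
Hypotheses (sv : s < v) (vt : v < t).

(** The strip has infinitely many vertices, so runs are confined to a window between two bridges,
    where only finitely many steps are possible. *)
Definition labelled_within (L : vertex -> option nat) : Prop :=
  reachable T (Lower v) L /\ forall p, L (Lower p) <> None -> s <= p /\ p <= t.

Lemma set_label_within L w x : labelled_within L -> L w = None ->
  in_window s t (collapse w) -> reachable T (Lower v) (set_label L w x) ->
  labelled_within (set_label L w x).
Proof.
move=> [_ LW] Lw ww rL; split=> // p; rewrite /set_label same_label_collapse /=.
by case: eqP => [e|_]; [move: ww; rewrite -e|apply: LW].
Qed.

Lemma initial_within : labelled_within (initial_labels T (Lower v)).
Proof.
split; first exact: reachable_initial.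
move=> p; rewrite initial_labels_collapse /=; case: eqP => [[->] _|_]; first by lia.
case: asboolP => // -[] Ee _; have lt := edge_lt S Ee.
- split; first by lia.
  by rewrite leNgt; apply/negP => tp; apply: (edge_bridge_nc S Ee Bt).
- split; last by lia.
  by rewrite leNgt; apply/negP => tp; apply: (edge_bridge_nc S Ee Bs).
Qed.

(** A side reaching outside the window would be an edge over the bridge at s or t. Thus the lower
    triangles, which the procedure must treat first, never force a run out of the window. *)
Lemma lower_completion_within L w x : labelled_within L ->
  completes (lower_triangle T) L w x -> in_window s t (collapse w).
Proof.
move=> [_ LW] [w1 [w2 [x1 [x2 [[]]]]]].
case: w1 w2 w => [k|p] [l|q] [m|r] //= _ _ _ [/(joined_lower _ _ ncT) pq
  /(joined_lower _ _ ncT) qr /(joined_lower _ _ ncT) pr] Lp Lq _ _.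
have [sp pt] : s <= p /\ p <= t by apply: LW; rewrite Lp.
have [sq qt] : s <= q /\ q <= t by apply: LW; rewrite Lq.
have lt a b : edge T a b -> a < b by move/(edge_lt S).
have pq' : p <> q by case: pq => /lt; lia.
split; rewrite leNgt; apply/negP => h.
- have [ps|qs] : s < p \/ s < q by lia.
  + by case: pr => Ee; [have := lt _ _ Ee; lia|apply: (edge_bridge_nc S Ee Bs)].
  + by case: qr => Ee; [have := lt _ _ Ee; lia|apply: (edge_bridge_nc S Ee Bs)].
- have [ps|qs] : p < t \/ q < t by lia.
  + by case: pr => Ee; [apply: (edge_bridge_nc S Ee Bt)|have := lt _ _ Ee; lia].
  + by case: qr => Ee; [apply: (edge_bridge_nc S Ee Bt)|have := lt _ _ Ee; lia].
Qed.

(** One representative per collapsed vertex of the window; the number of unlabeled ones decreases at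
    every step. *)
Let reps : seq vertex :=
  Upper 0 :: [seq Lower (s + i%:Z) | i <- iota 0 (absz (t - s)).+1].
Let todo (L : vertex -> option nat) : nat := count (fun w => L w == None) reps.

Lemma todo_lt L w x : labelled_within L -> L w = None -> in_window s t (collapse w) ->
  (todo (set_label L w x) < todo L)%N.
Proof.
move=> [rL _] Lw ww; have [Lc _ _ _ _] := reachable_inv rL.
have [z zin zw] : exists2 z, z \in reps & collapse z = collapse w.
  case: w Lw ww => [k|p] Lw /= ww; first by exists (Upper 0); rewrite // inE eqxx.
  exists (Lower p) => //; rewrite inE; apply/orP; right; apply/mapP.
  exists (absz (p - s)); last by congr Lower; lia.
  by rewrite mem_iota; lia.
apply: (count_lt (z := z)) => //.
- by move=> y; rewrite /set_label; case: ifP.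
- by rewrite (Lc _ _ zw) Lw.
- by rewrite /set_label same_label_collapse zw eqxx.
Qed.

Lemma saturated_labels : exists2 L, labelled_within L &
  forall w x, in_window s t (collapse w) ->
    ~ completes (lower_triangle T) L w x /\ ~ completes (upper_triangle T) L w x.
Proof.
have [k] : exists k, (todo (initial_labels T (Lower v)) <= k)%N.
  by exists (todo (initial_labels T (Lower v))).
elim: k (initial_labels T (Lower v)) initial_within => [|k IH] L LW hk.
all: have [[w [x [ww comp]]]|sat] := pselect (exists w x, in_window s t (collapse w) /\
  (completes (lower_triangle T) L w x \/ completes (upper_triangle T) L w x)).
all: try by exists L => // w x ww; split=> comp; apply: sat; exists w, x; split=> //;
  [left|right].
all: have [_ [_ [_ [_ [_ _ _ Lw _]]]]] := completes_triad comp.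
  by have := todo_lt x LW Lw ww; lia.
(* Lower triangles have priority wherever they lie, so w is labeled through an upper triangle only
   when no lower completion is left. *)
have [[u [y low]]|nolow] := pselect (exists u y, completes (lower_triangle T) L u y).
- have uw := lower_completion_within LW low.
  have [|_ [_ [_ [_ [_ _ _ Lu _]]]]] := @completes_triad L u y; first by left.
  apply: (IH (set_label L u y)); last by have := todo_lt y LW Lu uw; lia.
  by apply: set_label_within => //; apply: reachable_lower => //; case: LW.
- apply: (IH (set_label L w x)); last by have := todo_lt x LW Lw ww; lia.
  apply: set_label_within => //; case: comp => [low|up]; first by case: nolow; exists w, x.
  apply: reachable_upper => //; first by case: LW.
  by move=> u y low; apply: nolow; exists u, y.
Qed.

(** In a saturated run the labeled vertices form a set closed under completing triangles in the
    window, and v and v + 1 belong to it. *)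
Lemma labelled_in_window p : s <= p -> p <= t ->
  exists2 L, reachable T (Lower v) L & L (Lower p) <> None.
Proof.
move=> sp pt; have [L [rL LW] sat] := saturated_labels; exists L => //.
have [Lc _ _ Ls La] := reachable_inv rL.
pose K o := L (if o is Some q then Lower q else Upper 0) <> None.
have KL w : K (collapse w) <-> L w <> None.
  by rewrite /K; case: w => [k|q] //=; rewrite (Lc (Upper k) (Upper 0)).
have closed x y z : triadT x y z -> K x -> K y -> in_window s t z -> K z.
  move=> tr Kx Ky wz; have [w1 [w2 [w3 [e1 e2 e3 tr']]]] := triad_realized tr.
  move: Kx Ky wz; rewrite -e1 -e2 -e3 => /KL K1 /KL K2 wz; apply/KL => Lw.
  case L1: (L w1) K1 => [x1|//] _; case L2: (L w2) K2 => [x2|//] _.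
  have [nlow nup] := sat w3 (x1 + x2)%N wz.
  by case: tr' => tr'; [apply: nlow|apply: nup]; exists w1, w2, x1, x2.
apply: (closed_window S Bs Bt closed (v := v)) => //.
by apply/(KL (Lower (v + 1)))/La; left; apply: (edge_succ S).
Qed.

End Window.

(** A window containing v and p gives a run that labels p; every other run gives the same value,
    since [label_inv] fixes it. *)
Lemma label_fdist p : label T (Lower v) (Lower p) = F (Lower p).
Proof.
have [s sP Bs] := bridge_below S (Num.min v p).
have [t tP Bt] := bridge_above S (Num.max v p).
have [sv vt sp pt] : [/\ s < v, v < t, s <= p & p <= t] by split; lia.
have [L rL] := labelled_in_window Bs Bt sv vt sp pt.
case Lp: (L (Lower p)) => [x|//] _; apply: xget_unique => [|y [L' rL']].
- by exists L => //; rewrite Lp (label_inv_value (reachable_inv rL) Lp).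
- by apply: label_inv_value; apply: reachable_inv.
Qed.

End Labels.

Theorem theorem5p3 (n : nat) (T : set (vertex * vertex)) (m : int -> int -> int)
    (hn : (1 <= n)%N) (hT : periodic_triangulation n T)
    (hm : associated_frieze n T m) (i j k : int) (hij : -2 <= j - i) :
  m i j = (label T (lower_vertex n (i - 1) k) (lower_vertex n (j + 1) k))%:Z.
Proof.
have S := strip_of_triangulation hn hT; have [X [Y C]] := coordinates_exist S.
rewrite /lower_vertex (label_fdist hn hT C) /=.
have {hij} [ij|ij] : j = i - 2 \/ i - 1 <= j by lia.
  rewrite ij (frieze_pdet hn hT C hm); last by lia.
  have e : i - 2 + 1 = i - 1 by lia.
  by rewrite !e /fdist !pdetxx.
rewrite (fdist_lt S C); last by lia.
(* Periodicity of [m] is assumed only for i <= j, so the row of ones is treated apart. In the other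
   rows the frieze is shifted by k periods to match the vertices with superscript shifted by k. *)
have [jE|ij'] : j = i - 1 \/ i <= j by lia.
  case: (hm) => -[_ m1 _ _] _ _; rewrite jE m1 subrK.
  have -> : i + k * n%:Z = i - 1 + k * n%:Z + 1 by lia.
  by rewrite (pdet_edge C (edge_succ S _)).
case: (hm) => _ mper _; rewrite -(periodic_friezeM k mper ij').
rewrite (frieze_pdet hn hT C hm); last by lia.
by congr (pdet X Y (Some _) (Some _)); lia.
Qed.
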